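(* Let $p$ be a prime and let $G$ be a finite $p$-group, and suppose that $G$ belongs to one of the following families: (i) regular $p$-groups, and in particular groups of order at most $p^p$; (ii) potent $p$-groups, and in particular powerful $p$-groups; (iii) generalised $p$-central $p$-groups, and in particular $p$-central $p$-groups; (iv) for odd $p$, groups satisfying the condition $\Omega_1(\gamma_{p-1}(G))\le Z(G)$. Then $G$ is a Beauville group if and only if $p\ge 5$ and $|G^{p^{e-1}}|\ge p^2$, where $\exp G=p^e$.
   Context: For a finite $p$-group $G$, $\exp G$ is the maximum of the orders of all elements of $G$; $G^{p^i}$ is the subgroup generated by all powers $g^{p^i}$, $g\in G$ (so for $p=2$, $G^4$ is the subgroup generated by all fourth powers); $\Omega_i(G)$ is the subgroup generated by all elements of order at most $p^i$; $\gamma_j(G)$ and $Z_j(G)$ are the terms of the lower and upper central series, $G'$ is the derived subgroup and $Z(G)$ the centre. A finite $p$-group $G$ is: regular if for all $x,y\in G$ one has $(xy)^p=x^py^p\,d$ with $d$ a product of $p$th powers of elements of $\langle x,y\rangle'$; potent if $\gamma_{p-1}(G)\le G^p$ for $p$ odd, and $G'\le G^4$ for $p=2$; powerful if $G'\le G^p$ for $p$ odd, and $G'\le G^4$ for $p=2$; generalised $p$-central if $\Omega_1(G)\le Z_{p-2}(G)$ for $p$ odd, and $\Omega_2(G)\le Z(G)$ for $p=2$; $p$-central if $\Omega_1(G)\le Z(G)$ for $p$ odd, and $\Omega_2(G)\le Z(G)$ for $p=2$. For $x,y\in G$ let $\Sigma(x,y)=\bigcup_{g\in G}\big(\langle x\rangle^g\cup\langle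 y\rangle^g\cup\langle xy\rangle^g\big)$. A Beauville structure for $G$ is a pair of generating sets $\{x_1,y_1\}$, $\{x_2,y_2\}$ of $G$ such that $\Sigma(x_1,y_1)\cap\Sigma(x_2,y_2)=1$. $G$ is a Beauville group if it has a Beauville structure.
   Formalization: The formal theorem assumes that G is nontrivial and can be generated by two elements; without the latter the claim fails, e.g. for (Z/5)^3, which is regular with |G^{p^{e-1}}| = 125 but has no generating pair, and for G = 1 the expression p^{e-1} is undefined. *)

(* Defs.v *)
From mathcomp Require Import all_boot all_fingroup all_solvable.

Set Implicit Arguments.
Unset Strict Implicit.
Unset Printing Implicit Defensive.

Local Open Scope group_scope.

(* For a finite p-group G, G^{p^i} is 'Mho^i(G) (lemma MhoE) and Omega_i(G)   *)
(* is 'Ohm_i(G) (lemma OhmE); the definitions below are only meant for        *)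
(* p-groups.  The lower central series is indexed so that 'L_1(G) = G.        *)

Section PGroupFamilies.

Variables (gT : finGroupType) (p : nat).

Definition regular_pgroup (G : {set gT}) : Prop :=
  forall x y, x \in G -> y \in G ->
  exists2 s : seq gT, {subset s <= <<[set x; y]>>^`(1)} &
    (x * y) ^+ p = x ^+ p * y ^+ p * \prod_(z <- s) z ^+ p.

Definition potent (G : {set gT}) : bool :=
  if p == 2 then G^`(1) \subset 'Mho^2(G)
  else 'L_(p - 1)(G) \subset 'Mho^1(G).

Definition powerful (G : {set gT}) : bool :=
  if p == 2 then G^`(1) \subset 'Mho^2(G) else G^`(1) \subset 'Mho^1(G).

Definition generalised_pcentral (G : {set gT}) : bool :=
  if p == 2 then 'Ohm_2(G) \subset 'Z(G) else 'Ohm_1(G) \subset 'Z_(p - 2)(G).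

Definition pcentral (G : {set gT}) : bool :=
  if p == 2 then 'Ohm_2(G) \subset 'Z(G) else 'Ohm_1(G) \subset 'Z(G).

End PGroupFamilies.

Section Beauville.

Variable gT : finGroupType.

Definition Sigma (G : {set gT}) (x y : gT) : {set gT} :=
  \bigcup_(g in G) (<[x]> :^ g :|: <[y]> :^ g :|: <[x * y]> :^ g).

Definition Beauville_structure (G : {set gT}) (x1 y1 x2 y2 : gT) : Prop :=
  [/\ <<[set x1; y1]>> = G, <<[set x2; y2]>> = G &
      Sigma G x1 y1 :&: Sigma G x2 y2 = 1].

Definition Beauville (G : {set gT}) : Prop :=
  exists x1 y1 x2 y2, Beauville_structure G x1 y1 x2 y2.

Definition two_generator (G : {set gT}) : Prop :=
  exists x y, <<[set x; y]>> = G.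

End Beauville.

(* Main.v *)
Require Import Defs.
From mathcomp Require Import all_boot all_fingroup all_solvable.
From mathcomp Require Import ssralg poly zmodp zify.

Set Implicit Arguments.
Unset Strict Implicit.
Unset Printing Implicit Defensive.

Local Open Scope group_scope.

(** Let [p ^ e] be the exponent of [G] and [q = p ^ (e - 1)]. If [a] has order
    [p ^ e], then [a ^+ q] generates the subgroup of order [p] of [<[a]>], so
    whether conjugates of two maximal cyclic subgroups meet is decided by the map
    [x |-> x ^+ q]. [Beauville_criterion] reduces the theorem to three facts:
    the solutions of [x ^+ q = 1] lie in a proper subgroup; when
    ['Mho^(e - 1)(G)] has at least [p ^ 2] elements, [x ^+ q] determines the
    class of [x] modulo ['Phi(G)] for [x] outside ['Phi(G)]; and when moreover
    [p < 5], that class determines [x ^+ q] up to conjugacy. The first fact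
    makes two generating triples [x, y, x * y] meet if ['Mho^(e - 1)(G)] has
    order [p]. Otherwise [G / 'Phi(G)] is a plane with [p + 1] lines, and a
    triple meets three of them: for [p >= 5] two triples can be chosen on six
    different lines, and the second fact makes them disjoint; for [p <= 3] two
    triples share a line, and the third fact makes them meet.

    For all families except the potent groups with [p >= 5], the three facts
    follow from [power_injective q G]: one has [(x * w) ^+ q = x ^+ q] if and
    only if [w ^+ q = 1] ([Beauville_of_power_injective]). For the families that
    are not potent it suffices to treat [p]: [power_injective_iter] climbs from [p] to [p ^ k] through
    the quotients by ['Ohm_1(G)], which stay in the family. For [p], an
    induction on subgroups ([power_injective_of_der]) reduces to a subgroup [H]
    whose derived subgroup has exponent [p]. For most families the defining
    condition then forces [H] to have class less than [p], and such an [H]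
    satisfies [(x * y) ^+ p = x ^+ p * y ^+ p] ([expgM_small_class]).

    [expgM_small_class] is the only fragment of the Hall-Petrescu formula that
    is used, and it is proved without commutator collection. By induction on the
    class [c], the error [z] in the identity lies in the last lower central
    term, where [x |-> x ^+ a], [y |-> y ^+ a] acts as the power [a ^ c]; but
    the [p]-th powers are central and depend only on cosets of the derived
    subgroup, so the same substitution raises [z] to the power [a]. Hence
    [z ^+ (a ^ c) = z ^+ a], and a suitable [a] gives [z = 1].

    The power map of a potent group need not be injective in the above sense
    when [p >= 5]. Instead one uses the groups [M i j] obtained from
    ['L_i.+1(G)] by taking [j] times the subgroup generated by the [p]-th
    powers. They form a [power_filtration]: raising to the power [p ^ j] is
    multiplicative on [M i 0] modulo [M i.+1 j]. So [x |-> x ^+ q] is a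
    homomorphism modulo [M 1 (e - 1)], and if its kernel were not contained in
    ['Phi(G)], the commutators would force [M 1 (e - 1) = 1] and
    ['Mho^(e - 1)(G)] would be cyclic ([Beauville_of_potent]). A powerful
    2-group has such a filtration as well, and there, as for potent 3-groups,
    [M 1 (e - 1)] is trivial. *)

(** * The power map in groups of class less than p *)

Lemma coset_eqE (gT : finGroupType) (N : {group gT}) x y :
  x \in 'N(N) -> y \in 'N(N) -> (coset N x == coset N y) = (x^-1 * y \in N).
Proof.
move=> Nx Ny; apply/eqP/idP=> [exy | Nxy].
  apply: coset_idr; first by rewrite groupM ?groupV.
  by rewrite morphM ?groupV // morphV //= exy mulVg.
by rewrite -[y](mulKVg x) coset_kerr.
Qed.

Lemma coset_eq1E (gT : finGroupType) (N : {group gT}) x :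
  x \in 'N(N) -> (coset N x == 1) = (x \in N).
Proof.
by move=> Nx; rewrite eq_sym -(morph1 (coset N)) coset_eqE // invg1 mul1g.
Qed.

(** Three subgroup lemma: both [[L, G, G]] and [[G, L, G]] are trivial for
    [L = 'L_n.+1(G)]. *)
Lemma comm_lcn_der (gT : finGroupType) (G : {group gT}) n :
  'L_n.+3(G) = 1 -> [~: 'L_n.+1(G), G^`(1)] = 1.
Proof.
move=> L1; rewrite commGC.
by apply: three_subgroup; rewrite ?(commGC G) -?lcnSn.
Qed.

(** Commutation is bilinear modulo the next lower central term; [s] and [d] are
    the errors that this linearity discards. *)
Lemma commg_lcn_twist (gT : finGroupType) (G : {group gT}) n u x s d i k :
    'L_n.+3(G) = 1 -> u \in 'L_n.+1(G) -> x \in G -> s \in 'L_n.+2(G) ->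
    d \in G^`(1) ->
  [~ u ^+ i * s, x ^+ k * d] = [~ u, x] ^+ (i * k).
Proof.
move=> L1 Lu Gx Ls Gd.
have cL v y : v \in 'L_n.+2(G) -> y \in G -> commute v y.
  move=> Lv Gy; apply/commgP; rewrite -in_set1 -[[set 1]]L1 lcnSn.
  exact: mem_commg.
have cd v : v \in 'L_n.+1(G) -> commute v d.
  move=> Lv; apply/commgP; rewrite -in_set1.
  by rewrite -[[set 1]](comm_lcn_der L1) mem_commg.
have Lux : [~ u, x] \in 'L_n.+2(G) by rewrite lcnSn mem_commg.
have Gu : u \in G by apply: subsetP Lu; apply: lcn_sub.
have Lus : u ^+ i * s \in 'L_n.+1(G).
  by rewrite groupM ?groupX //; apply: subsetP Ls; apply: lcn_subS.
rewrite commgMJ (eqP (introT commgP (cd _ Lus))) mul1g commMgJ.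
have /commgP/eqP-> : commute s (x ^+ k) by apply: cL; rewrite ?groupX.
rewrite mulg1 commXXg; last 2 first.
- exact/commute_sym/cL.
- exact/commute_sym/cL.
have Lc : [~ u, x] ^+ (i * k) \in 'L_n.+2(G) by rewrite groupX.
have Gs : s \in G by apply: subsetP Ls; apply: lcn_sub.
have Gd' : d \in G by apply: subsetP Gd; apply: der_sub.
have cJ y : y \in G -> ([~ u, x] ^+ (i * k)) ^ y = [~ u, x] ^+ (i * k).
  by move=> Gy; rewrite conjgE (cL _ _ Lc Gy) mulKg.
by rewrite !cJ.
Qed.

(** The relation, inside [G * G], that the substitution [x |-> x ^+ a] of the
    generators would induce on the [n]-th lower central factor,
    where it is the power [a ^ n]. A relation is used because the
    substitution need not extend to an endomorphism of [G]. *)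
Definition twisted (gT : finGroupType) (G : {group gT}) (a n : nat) : {set gT * gT} :=
  [set u | [&& u.1 \in 'L_n(G), u.2 \in 'L_n(G)
             & coset 'L_n.+1(G) u.2 == coset 'L_n.+1(G) u.1 ^+ (a ^ n)]].

Lemma twisted_group_set (gT : finGroupType) (G : {group gT}) a n :
  group_set (twisted G a n.+1).
Proof.
have sLN : 'L_n.+1(G) \subset 'N('L_n.+2(G)).
  by rewrite (subset_trans (lcn_sub _ _)) ?lcn_norm.
apply/group_setP; split=> [|u v].
  by rewrite inE !group1 !morph1 expg1n eqxx.
rewrite !inE => /and3P[Lu1 Lu2 /eqP eu] /and3P[Lv1 Lv2 /eqP ev].
rewrite !groupM //= !morphM ?(subsetP sLN) //= eu ev expgMn //.
have /subsetP cL := lcn_central n.+1 G.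
have /centerP[_ cu] := cL _ (mem_quotient 'L_n.+2(G) Lu1).
apply: cu.
by have /setIP[] := cL _ (mem_quotient 'L_n.+2(G) Lv1).
Qed.

Lemma twisted_comm (gT : finGroupType) (G : {group gT}) a n u x :
    u \in twisted G a n.+1 -> x \in twisted G a 1 ->
  [~ u, x] \in twisted G a n.+2.
Proof.
rewrite !inE => /and3P[Lu1 Lu2 /eqP eu] /and3P[Gx1 Gx2 /eqP ex].
have e1 : [~ u, x].1 = [~ u.1, x.1] by [].
have e2 : [~ u, x].2 = [~ u.2, x.2] by [].
rewrite e1 e2 [in 'L_n.+2(G)]lcnSn !mem_commg //=.
have nL m : G \subset 'N('L_m(G)) := lcn_norm m G.
have sL m : 'L_m(G) \subset G := lcn_sub m G.
have Gu1 := subsetP (sL _) _ Lu1; have Gu2 := subsetP (sL _) _ Lu2.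
pose N := 'L_n.+3(G)%G; rewrite -[X in coset X _ == _]/(gval N).
rewrite -[X in _ == coset X _ ^+ _]/(gval N).
have nN : G \subset 'N(N) := nL _.
have LQ m : 'L_m(G) / N = 'L_m(G / N) by apply: morphim_lcn.
have Q1 : 'L_n.+3(G / N) = 1 by rewrite -LQ trivg_quotient.
have Ls : (u.1 ^+ (a ^ n.+1))^-1 * u.2 \in 'L_n.+2(G).
  rewrite -coset_eqE ?(subsetP (nL _)) ?groupX //=.
  by rewrite eu morphX ?(subsetP (nL _)).
have Gd : (x.1 ^+ a)^-1 * x.2 \in G^`(1).
  rewrite -(@coset_eqE _ 'L_2(G)%G) ?(subsetP (nL _)) ?groupX //=.
  by rewrite ex expn1 morphX ?(subsetP (nL 2)).
have inN y : y \in G -> y \in 'N(N) := subsetP nN y.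
have Gs := subsetP (sL _) _ Ls; have Gd' := subsetP (sL 2) _ Gd.
rewrite -[u.2](mulKVg (u.1 ^+ (a ^ n.+1))) -[x.2](mulKVg (x.1 ^+ a)).
set s := _^-1 * _ in Ls Gs *; set d := _^-1 * _ in Gd Gd' *; clearbody s d.
rewrite !morphR ?inN ?groupM ?groupX //=.
rewrite !morphM ?inN ?groupX //=.
rewrite !morphX ?inN //= (@commg_lcn_twist _ (G / N)%G n) //= -?expnSr //.
- by rewrite -LQ mem_quotient.
- exact: mem_quotient.
- by rewrite -LQ mem_quotient.
- by rewrite -[_^`(1)](LQ 2) mem_quotient.
Qed.

(** The polynomial ['X^(c.+2) - 'X] has too few roots to vanish on ['F_p]. *)
Lemma exp_neq_mod_prime p c : prime p -> c.+2 < p ->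
  exists a, a ^ c.+2 != a %[mod p].
Proof.
move=> p_pr ltcp; pose P : {poly 'F_p} := ('X^(c.+2) - 'X)%R.
have szP : size P = c.+3 by rewrite size_polyDl size_polyXn // size_polyN size_polyX.
have nzP : P != 0%R by rewrite -size_poly_eq0 szP.
have [allr | /allPn[a _ ra]] := boolP (all (root P) (enum 'F_p)).
  have := max_poly_roots nzP allr (enum_uniq _).
  by rewrite -cardE card_Fp // szP ltnNge ltcp.
exists (val a); apply: contraNneq ra => ea.
rewrite /root !hornerE -[a]natr_Zp GRing.subr_eq0 -GRing.natrX.
by apply/eqP/val_inj; rewrite /= !val_Fp_nat.
Qed.

Lemma commuting_gen_der (gT : finGroupType) (G N : {group gT}) x w :
    G \subset 'N(N) -> x \in G -> w \in G -> [~ x, w] \in N ->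
  (<[x]> <*> <[w]>)^`(1) \subset N.
Proof.
move=> nNG Gx Gw Nxw; have nN := subsetP nNG.
have sHG : <[x]> <*> <[w]> \subset 'N(N).
  by rewrite join_subG !cycle_subG !nN.
apply: der1_min => //; rewrite quotientY ?cycle_subG ?nN //.
rewrite abelianY !quotient_abelian ?cycle_abelian //=.
rewrite !quotient_cycle ?nN // cent_cycle cycle_subG.
apply/cent1P/commute_sym/commgP.
by rewrite -morphR ?nN //= coset_id.
Qed.

(** A generator taken in the derived subgroup counts for weight two, so the
    class drops by one. *)
Lemma lcn_cycle_der (gT : finGroupType) (G : {group gT}) n x w :
    x \in G -> w \in G^`(1) ->
  'L_n.+2(<[x]> <*> <[w]>) \subset 'L_n.+3(G).
Proof.
move=> Gx Gw; have Gw' := subsetP (der_sub 1 G) _ Gw.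
elim: n => [|n IHn].
  apply: (@commuting_gen_der _ G 'L_3(G)%G) => //; first exact: lcn_norm.
  by rewrite -groupV invg_comm /= lcnSn mem_commg.
rewrite [in X in X \subset _]lcnSn lcnSn commgSS //.
by rewrite join_subG !cycle_subG Gx.
Qed.

Lemma expg_pair (gT hT : finGroupType) (u : gT) (v : hT) n :
  (u, v) ^+ n = (u ^+ n, v ^+ n).
Proof. by elim: n => // n IHn; rewrite !expgS IHn. Qed.

(** The error [z] below has two weights: it is a product of commutators of
    weight [c], and the [p]-th power map, being central and constant on cosets of
    the derived subgroup, is homogeneous of weight one. No nontrivial [z] with
    [z ^+ p = 1] has both if [1 < c < p]. *)
Lemma expgM_small_class p : prime p -> forall c, c < p ->
  forall (gT : finGroupType) (G : {group gT}),
    'L_c.+1(G) = 1 -> {in G^`(1), forall w, w ^+ p = 1} ->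
  {in G &, forall x y, (x * y) ^+ p = x ^+ p * y ^+ p}.
Proof.
move=> p_pr; case=> [_ gT G | c].
  rewrite lcn1 => G1 _ x y; rewrite !G1 => /set1P-> /set1P->.
  by rewrite mulg1 !expg1n mulg1.
elim: c => [|c IHc] ltcp gT G L1 expG' x y Gx Gy.
  rewrite expgMn //; suffices abG: abelian G by apply: (centsP abG).
  exact/derG1P.
have {}IHc := IHc (ltnW ltcp).
have modL (hT : finGroupType) (H : {group hT}) (u v : hT) :
    {in H^`(1), forall w, w ^+ p = 1} -> u \in H -> v \in H ->
  (u ^+ p * v ^+ p)^-1 * (u * v) ^+ p \in 'L_c.+2(H).
  move=> expH' Hu Hv; have nLH := subsetP (lcn_norm c.+2 H).
  rewrite -coset_eqE ?nLH ?(groupM, groupX) //.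
  rewrite !(morphM, morphX) ?nLH ?(groupM, groupX) //= eq_sym.
  apply/eqP/(IHc _ (H / 'L_c.+2(H))%G); rewrite ?mem_quotient //.
    rewrite -[LHS](morphim_lcn (coset_morphism _)) ?lcn_norm //.
    exact: trivg_quotient.
  move=> w; rewrite /= -quotient_der ?lcn_norm // => /morphimP[w0 Nw0 H'w0 ->].
  by rewrite -morphX // expH' // morph1.
have cL z u : z \in 'L_c.+2(G) -> u \in G -> commute z u.
  move=> Lz Gu; apply/commgP; rewrite -in_set1 -[[set 1]]L1 lcnSn.
  exact: mem_commg.
(* as conjugation moves u inside its coset of G^`(1), u ^+ p is also central *)
have expMder u w : u \in G -> w \in G^`(1) -> (u * w) ^+ p = u ^+ p.
  move=> Gu Gw.
  have sHG : <[u]> <*> <[w]> \subset G.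
    by rewrite join_subG !cycle_subG Gu (subsetP (der_sub 1 G)).
  rewrite (IHc _ (<[u]> <*> <[w]>)%G).
  - by rewrite (expG' w) ?mulg1.
  - by apply/trivgP; rewrite -[[1]]L1 lcn_cycle_der.
  - by move=> v Hv; rewrite expG' // (subsetP (dergS 1 sHG)).
  - by rewrite mem_gen // inE cycle_id.
  by rewrite mem_gen // inE cycle_id orbT.
have cX u v : u \in G -> v \in G -> commute (u ^+ p) v.
  move=> Gu Gv; apply/commgP/conjg_fixP.
  by rewrite conjXg conjg_mulR expMder // mem_commg.
have [a neq_a] := exp_neq_mod_prime p_pr ltcp.
(* the subgroup D of the graph generated by the substituted pairs *)
pose X := (x, x ^+ a); pose Y := (y, y ^+ a).
pose D := <<[set X; Y]>>.
have gT1 u : u \in G -> (u, u ^+ a) \in twisted G a 1.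
  move=> Gu; rewrite inE /= groupX // Gu expn1 morphX //=.
  exact: (subsetP (lcn_norm 2 G)).
have sD n : 'L_n.+1(D) \subset twisted G a n.+1.
  elim: n => [|n IHn].
    rewrite lcn1 (@gen_subG _ _ (Group (twisted_group_set G a 0))).
    by apply/subsetP=> u /set2P[]->; apply: gT1.
  rewrite lcnSn (@gen_subG _ _ (Group (twisted_group_set G a n.+1))).
  apply/subsetP=> _ /imset2P[u v Du Dv ->]; apply: twisted_comm.
    exact: (subsetP IHn).
  apply: subsetP Dv; rewrite (@gen_subG _ _ (Group (twisted_group_set G a 0))).
  by apply/subsetP=> t /set2P[]->; apply: gT1.
pose z := (x ^+ p * y ^+ p)^-1 * (x * y) ^+ p.
have Lz : z \in 'L_c.+2(G) by apply: modL.
have zp : z ^+ p = 1.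
  by apply: expG'; rewrite -lcn2; apply: subsetP Lz; apply: lcn_sub_leq.
have eZ : (X ^+ p * Y ^+ p)^-1 * (X * Y) ^+ p = (z, z ^+ a).
  rewrite !expg_pair; congr pair => /=.
  have Gz : z \in G by apply: subsetP Lz; apply: lcn_sub.
  have [d Gd ->] : exists2 d, d \in G^`(1) & x ^+ a * y ^+ a = (x * y) ^+ a * d.
    exists (((x * y) ^+ a)^-1 * (x ^+ a * y ^+ a)); last by rewrite mulKVg.
    have nG'G := subsetP (der_norm 1 G).
    rewrite -coset_eqE ?nG'G ?(groupM, groupX) //.
    rewrite !(morphM, morphX) ?nG'G ?(groupM, groupX) //= expgMn //.
    have /centsP cG : abelian (G / G^`(1)) by apply: (der_abelian 0).
    by apply: cG; apply: mem_quotient.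
  have exy : (x * y) ^+ p = x ^+ p * y ^+ p * z by rewrite mulKVg.
  rewrite expMder ?(groupX, groupM) // -!expgM !(mulnC a p) !expgM exy.
  have cxyz : commute (x ^+ p * y ^+ p) z.
    exact/commute_sym/(cL _ _ Lz (groupM (groupX _ Gx) (groupX _ Gy))).
  have cxy : commute (x ^+ p) (y ^+ p) by apply: cX; rewrite ?groupX.
  by rewrite (expgMn _ cxyz) (expgMn _ cxy) mulKg.
have /(subsetP (sD _)): (X ^+ p * Y ^+ p)^-1 * (X * Y) ^+ p \in 'L_c.+2(D).
  apply: modL; last 2 first; try by rewrite mem_gen // ?set21 ?set22.
  move=> w /(subsetP (sD 1%N)); rewrite inE => /and3P[w1 w2 _].
  by rewrite [w]surjective_pairing expg_pair !expG'.
rewrite eZ inE => /and3P[_ _] /=.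
rewrite -morphX /= ?(subsetP (lcn_norm _ G)) //; last first.
  by apply: subsetP Lz; apply: lcn_sub.
rewrite coset_eqE ?(subsetP (lcn_norm _ G)) ?groupX //; last 2 first.
  by apply: subsetP Lz; apply: lcn_sub.
  by apply: subsetP Lz; apply: lcn_sub.
rewrite /= L1 in_set1 -eq_mulVg1 eq_sym eq_expg_mod_order => eaz.
apply/esym/eqP; rewrite eq_mulVg1 -/z -order_eq1.
have /(primeP p_pr).2/orP[//|/eqP oz] : #[z] %| p by rewrite order_dvdn zp.
by move: neq_a; rewrite -oz eaz.
Qed.

(** * Groups with an injective power map *)

(** By [power_injectiveE], [x ^+ n = y ^+ n] exactly when [x] and [y] agree
    modulo the solutions of [w ^+ n = 1]. *)
Definition power_injective (gT : finGroupType) (n : nat) (G : {set gT}) :=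
  {in G &, forall x w, ((x * w) ^+ n == x ^+ n) = (w ^+ n == 1)}.

Section PowerInjective.

Variable gT : finGroupType.
Implicit Types G H : {group gT}.

Lemma Ldiv_group_set n G : power_injective n G -> group_set 'Ldiv_n(G).
Proof.
move=> injG; apply/group_setP; split=> [|x y].
  by apply/LdivP; rewrite expg1n.
move=> /LdivP[Gx xn] /LdivP[Gy yn]; apply/LdivP; split; first exact: groupM.
by rewrite -xn; apply/eqP; rewrite injG // yn.
Qed.

Lemma power_injectiveE n G x y : power_injective n G -> x \in G -> y \in G ->
  (x ^+ n == y ^+ n) = ((x^-1 * y) ^+ n == 1).
Proof. by move=> injG Gx Gy; rewrite -(injG x) ?groupM ?groupV // mulKVg. Qed.

Lemma power_injective_of_multiplicative n G :
  {in G &, forall x y, (x * y) ^+ n = x ^+ n * y ^+ n} -> power_injective n G.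
Proof.
move=> mulG x y Gx Gy; rewrite mulG //.
by rewrite -{2}[x ^+ n]mulg1 (inj_eq (mulgI _)).
Qed.

(** Otherwise [u] alone would generate [K], since the derived subgroup consists
    of non-generators, and [K] would be cyclic. *)
Lemma proper_cycle_der (p : nat) (K : {group gT}) u :
  p.-group K -> ~~ abelian K -> u \in K -> <[u]> <*> K^`(1) \proper K.
Proof.
move=> pK; rewrite properE join_subG cycle_subG der_sub andbT => + Ku.
rewrite Ku /=; apply: contra => sK.
suffices <-: <[u]> = K by apply: cycle_abelian.
rewrite -[<[u]>]genGid; apply: Phi_nongen; apply/eqP.
rewrite eqEsubset join_subG Phi_sub cycle_subG Ku (Phi_joing pK).
apply: subset_trans sK _; rewrite join_subG joing_subr.
  by rewrite (subset_trans (joing_subl _ 'Mho^1(K))) ?joing_subl.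
Qed.

(** Either of [(x * w) ^+ p = x ^+ p] and [w ^+ p = 1] makes a [p]-th power
    invariant under conjugation by the other element, hence gives an instance of
    the claim inside a proper subgroup of [K = <x, w>], whose outcome is
    [[~ x, w] ^+ p = 1]. The derived subgroup of [K] is generated by conjugates
    of that commutator, so it has exponent [p]. *)
Lemma power_injective_of_der (p : nat) G :
    p.-group G ->
    (forall H, H \subset G -> {in H^`(1), forall w, w ^+ p = 1} ->
       power_injective p H) ->
  power_injective p G.
Proof.
move=> pG hyp; have [n] := ubnP #|G|; move: {-2}G (subxx G).
elim: n => // n IHn H sHG; rewrite ltnS => leHn x w Hx Hw.
pose K := (<[x]> <*> <[w]>)%G.
have sKH : K \subset H by rewrite join_subG !cycle_subG Hx.
have Kx : x \in K by rewrite mem_gen // inE cycle_id.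
have Kw : w \in K by rewrite mem_gen // inE cycle_id orbT.
have pK : p.-group K by rewrite (pgroupS _ pG) // (subset_trans sKH).
have [abK | nabK] := boolP (abelian K).
  apply: (@power_injective_of_multiplicative p K) => // u v Ku Kv.
  exact/expgMn/(centsP abK).
have IHK (L : {group gT}) : L \proper K -> power_injective p L.
  move=> prLK; apply: IHn.
    by rewrite (subset_trans (proper_sub prLK)) ?(subset_trans sKH).
  exact: leq_trans (leq_trans (proper_card prLK) (subset_leq_card sKH)) leHn.
suffices cp : [~ x, w] ^+ p = 1 -> {in K^`(1), forall v, v ^+ p = 1}.
  have Kc u v : u \in K -> v \in K -> [~ u, v] \in <[u]> <*> K^`(1).
    by move=> Ku Kv; rewrite mem_gen // inE mem_commg ?orbT.
  have Ku u : u \in <[u]> <*> K^`(1) by rewrite mem_gen // inE cycle_id.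
  have pr u : u \in K -> power_injective p (<[u]> <*> K^`(1)).
    by move=> Ku'; apply: IHK; apply: proper_cycle_der pK _ _.
  have hypK : [~ x, w] ^+ p = 1 -> power_injective p K.
    by move=> c1; apply: hyp; [apply: subset_trans sHG | apply: cp].
  apply/idP/idP=> [/eqP exw | /eqP w1].
    rewrite -(hypK _ x w) ?exw //; apply/eqP.
    rewrite -(pr x Kx x) ?Kc // -conjg_mulR -conjXg.
    apply/eqP/conjg_fixP/commgP; rewrite -exw.
    have cxw : commute ((x * w) ^+ p) (x * w).
      exact/commute_sym/commuteX.
    have cx : commute ((x * w) ^+ p) x.
      by rewrite exw; apply/commute_sym/commuteX.
    by have := commuteM (commuteV cx) cxw; rewrite mulKg.
  rewrite (hypK _ x w) ?w1 // -invg_comm expgVn; apply/eqP; rewrite eq_invg1.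
  rewrite -(pr w Kw w) ?Kc //.
  by rewrite -conjg_mulR -conjXg w1 conj1g.
move=> c1.
have prK' : K^`(1) \proper K.
  apply: sub_proper_trans (proper_cycle_der pK nabK Kx); exact: joing_subr.
have injK' := IHK _ prK'.
suffices sK' : K^`(1) \subset Group (Ldiv_group_set injK').
  by move=> v /(subsetP sK') /LdivP[].
have sN : <<[~ x, w] ^: K>> \subset Group (Ldiv_group_set injK').
  rewrite gen_subG; apply/subsetP=> _ /imsetP[k Kk ->].
  apply/LdivP; rewrite -conjXg c1 conj1g; split=> //.
  by rewrite memJ_norm ?mem_commg // (subsetP (der_norm 1 K)).
apply: subset_trans sN.
apply: (@commuting_gen_der _ K <<[~ x, w] ^: K>>%G) => //.
  by rewrite norms_gen ?class_norm.
by rewrite mem_gen ?class_refl.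
Qed.

Lemma Ohm1_power_injective (p : nat) G : prime p -> p.-group G -> power_injective p G ->
  'Ohm_1(G) = 'Ldiv_p(G).
Proof.
move=> p_pr pG injG; rewrite (OhmE _ pG) expn1.
exact: (genGid (Group (Ldiv_group_set injG))).
Qed.

End PowerInjective.

(** In [G / 'Ohm_1(G)] equality means equality of [p]-th powers in [G], so the
    property for [p ^ k] in the quotient is the property for [p ^ k.+1] in [G]. *)
Lemma power_injective_iter (p : nat) (P : forall gT : finGroupType, {group gT} -> Prop) :
    prime p ->
    (forall gT (G : {group gT}), P gT G ->
      [/\ p.-group G, power_injective p G & P _ (G / 'Ohm_1(G))%G]) ->
  forall k gT (G : {group gT}), P gT G -> power_injective (p ^ k) G.
Proof.
move=> p_pr hP; elim=> [|k IHk] gT G PG x w Gx Gw.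
  by rewrite !expg1 -{2}[x]mulg1 (inj_eq (mulgI _)).
have [pG injG PQ] := hP _ _ PG; have injQ := IHk _ _ PQ.
have defO := Ohm1_power_injective p_pr pG injG.
have nO := subsetP (char_norm (Ohm_char 1 G)).
have memO y : y \in G -> (y ^+ p == 1) = (y \in 'Ohm_1(G)).
  by move=> Gy; rewrite defO !inE Gy.
have Gk y : y \in G -> y ^+ (p ^ k) \in G by apply: groupX.
have Gxw : x * w \in G by rewrite groupM.
have := injQ _ _ (mem_quotient 'Ohm_1(G) Gx) (mem_quotient 'Ohm_1(G) Gw).
rewrite -morphM ?nO // -!morphX ?nO //=.
rewrite (coset_eqE (nO _ (Gk _ Gxw)) (nO _ (Gk _ Gx))).
rewrite (coset_eq1E (nO _ (Gk _ Gw))) /= -!memO ?groupM ?groupV ?Gk //.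
by rewrite expnSr !expgM (power_injectiveE injG) ?Gk.
Qed.

(** * Families with an injective power map *)

(** Both sides say that [x] and its conjugate under [g] have the same [n]-th
    power. *)
Lemma power_injective_comm (gT : finGroupType) (G : {group gT}) n x g :
    power_injective n G -> x \in G -> g \in G ->
  ([~ x, g] ^+ n == 1) = ([~ x ^+ n, g] == 1).
Proof.
move=> injG Gx Gg; rewrite -(injG x) ?groupR // -conjg_mulR -conjXg.
by rewrite eq_sym commgEl -eq_mulVg1.
Qed.

Lemma coset_prod_expg (gT : finGroupType) (N : {group gT}) n (s : seq gT) :
    {subset s <= 'N(N)} ->
  \prod_(z <- s) z ^+ n \in 'N(N) /\
  coset N (\prod_(z <- s) z ^+ n) = \prod_(z <- map (coset N) s) z ^+ n.
Proof.
elim: s => [|z s IHs] sN; first by rewrite !big_nil morph1.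
have [|Ns es] := IHs; first by move=> t st; rewrite sN // inE st orbT.
have Nz : z \in 'N(N) by rewrite sN ?mem_head.
by rewrite !big_cons groupM ?groupX // morphM ?groupX // morphX //= es.
Qed.

Section Families.

Variables (p : nat) (p_pr : prime p).

Lemma Ohm1_quotient_sub (gT : finGroupType) (N A : {group gT}) (C : {group coset_of N}) :
  p.-group A -> A \subset 'N(N) ->
  (forall x, x \in A -> x ^+ p \in N -> coset N x \in C) ->
  'Ohm_1(A / N) \subset C.
Proof.
move=> pA nNA hyp; rewrite (OhmE _ (quotient_pgroup _ pA)) expn1 gen_subG.
apply/subsetP=> _ /LdivP[/morphimP[x Nx Ax ->] xp]; apply: hyp => //.
by apply: coset_idr; rewrite ?groupX // morphX.
Qed.

Lemma power_injective_regular k (gT : finGroupType) (G : {group gT}) :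
  p.-group G -> regular_pgroup p G -> power_injective (p ^ k) G.
Proof.
move=> pG regG.
apply: (@power_injective_iter p
  (fun _ G => p.-group G /\ regular_pgroup p G)) => // {}gT {pG regG}G [pG regG].
split=> //; last first.
  split; first exact: quotient_pgroup.
  move=> _ _ /morphimP[x Nx Gx ->] /morphimP[y Ny Gy ->].
  have [s sS exy] := regG x y Gx Gy.
  have nS z : z \in <<[set x; y]>> -> z \in 'N('Ohm_1(G)).
    apply: subsetP; rewrite gen_subG; apply/subsetP=> t /set2P[]->//.
  have nS' z : z \in s -> z \in 'N('Ohm_1(G)).
    by move=> /sS sz; rewrite nS // (subsetP (der_sub 1 _)).
  have [Ns es] := coset_prod_expg p nS'.
  exists (map (coset 'Ohm_1(G)) s).
    move=> _ /mapP[z /[dup] sz /sS S'z ->].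
    have -> : [set coset 'Ohm_1(G) x; coset 'Ohm_1(G) y] = [set x; y] / 'Ohm_1(G).
      by rewrite /quotient morphimU !morphim_set1.
    rewrite -quotient_gen; last by apply/subsetP=> t /set2P[]->.
    rewrite -quotient_der; last by apply/subsetP.
    by rewrite mem_quotient.
  by rewrite -morphM // -!morphX ?groupM //= exy !morphM ?groupM ?groupX //= es.
apply: (power_injective_of_der pG) => H sHG expH'.
apply: power_injective_of_multiplicative => x y Hx Hy.
have [s sS ->] := regG x y (subsetP sHG _ Hx) (subsetP sHG _ Hy).
rewrite big1_seq ?mulg1 // => z /andP[_ /sS zS]; apply: expH'.
apply: subsetP zS; apply: dergS; rewrite gen_subG.
by apply/subsetP=> t /set2P[]->.
Qed.

Lemma power_injective_lcn k (gT : finGroupType) (G : {group gT}) :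
  p.-group G -> 'L_p(G) = 1 -> power_injective (p ^ k) G.
Proof.
move=> pG L1.
apply: (@power_injective_iter p
  (fun _ G => p.-group G /\ 'L_p(G) = 1)) => // {}gT {pG L1}G [pG L1].
split=> //; last first.
  split; first exact: quotient_pgroup.
  rewrite -[LHS](morphim_lcn (coset_morphism _)) ?char_norm ?Ohm_char // L1.
  exact: morphim1.
apply: (power_injective_of_der pG) => H sHG expH'.
apply: power_injective_of_multiplicative.
apply: (@expgM_small_class _ p_pr p.-1) => //.
  by rewrite prednK ?prime_gt0.
by apply/trivgP; rewrite prednK ?prime_gt0 // -L1 lcnS.
Qed.

(** For the subgroup [H] of [power_injective_of_der], the elements of
    ['L_(p - 1)(H)] have order dividing [p] and lie in ['L_(p - 1)(G)], so they
    are central and [H] has class less than [p]. *)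
Lemma power_injective_Ohm_lcn k (gT : finGroupType) (G : {group gT}) :
    odd p -> p.-group G -> 'Ohm_1('L_(p - 1)(G)) \subset 'Z(G) ->
  power_injective (p ^ k) G.
Proof.
move=> p_odd pG ZG.
have p_gt2 : 2 < p by rewrite odd_prime_gt2.
have [m ep ep1] : exists2 m, p = m.+3 & (p - 1 = m.+2)%N.
  by exists (p - 3)%N; rewrite ?subn1 -[p in LHS](subnK p_gt2) ?addn3.
apply: (@power_injective_iter p (fun _ G => p.-group G /\
  'Ohm_1('L_(p - 1)(G)) \subset 'Z(G))) => // {}gT {pG ZG}G [pG ZG].
have pL : p.-group 'L_(p - 1)(G) := pgroupS (lcn_sub _ _) pG.
have LZ x : x \in 'L_(p - 1)(G) -> x ^+ p = 1 -> x \in 'Z(G).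
  move=> Lx xp; apply: (subsetP ZG); rewrite (OhmE _ pL) mem_gen //.
  exact/LdivP.
have injG : power_injective p G.
  apply: (power_injective_of_der pG) => H sHG expH'.
  apply: power_injective_of_multiplicative.
  apply: (@expgM_small_class _ p_pr p.-1) => //; rewrite prednK ?prime_gt0 //.
  apply/trivgP; suffices: 'L_m.+3(H) \subset [1] by rewrite -ep.
  rewrite lcnSn gen_subG.
  apply/subsetP=> _ /imset2P[u v Lu Hv ->]; rewrite in_set1.
  apply/commgP; have Gv := subsetP sHG _ Hv.
  suffices /centerP[_ cu] : u \in 'Z(G) by apply: cu.
  apply: LZ; first by rewrite ep1; apply: subsetP Lu; apply: lcnS.
  apply: expH'; rewrite -lcn2; apply: subsetP Lu; exact: lcn_sub_leq.
have defO := Ohm1_power_injective p_pr pG injG.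
have nO := char_norm (Ohm_char 1 G).
split=> //; split; first exact: quotient_pgroup.
have <-: 'L_(p - 1)(G) / 'Ohm_1(G) = 'L_(p - 1)(G / 'Ohm_1(G)).
  exact: morphim_lcn.
apply: (@Ohm1_quotient_sub _ 'Ohm_1(G)%G _ 'Z(G / 'Ohm_1(G))%G pL).
  exact: subset_trans (lcn_sub _ _) nO.
move=> x Lx Oxp; have Gx := subsetP (lcn_sub _ _) _ Lx.
apply/centerP; split=> [|_ /morphimP[g Ng Gg ->]]; first exact: mem_quotient.
apply/commgP; rewrite -morphR ?(subsetP nO) //=.
rewrite (coset_eq1E (subsetP nO _ (groupR Gx Gg))).
rewrite /= defO; apply/LdivP; split; first by rewrite groupR.
apply/eqP; rewrite (power_injective_comm injG) //; apply/commgP.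
suffices /centerP[_ cx] : x ^+ p \in 'Z(G) by apply: cx.
apply: LZ; first exact: groupX.
by move: Oxp; rewrite /= defO => /LdivP[].
Qed.

(** The subgroup [H] of [power_injective_of_der] has class at most 2 here, but
    squaring need not be multiplicative on [H]: the
    argument uses instead that [w] is central as soon as [w ^+ 4 = 1]. *)
Lemma power_injective_2central k (gT : finGroupType) (G : {group gT}) :
    p = 2 -> p.-group G -> 'Ohm_2(G) \subset 'Z(G) ->
  power_injective (p ^ k) G.
Proof.
move=> p2 pG ZG.
apply: (@power_injective_iter p (fun _ G => p.-group G /\
  'Ohm_2(G) \subset 'Z(G))) => // {}gT {pG ZG}G [pG ZG].
have LZ x : x \in G -> x ^+ 4 = 1 -> x \in 'Z(G).
  move=> Lx xp; apply: (subsetP ZG); rewrite (OhmE _ pG) mem_gen //.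
  by apply/LdivP; rewrite p2.
have injG : power_injective p G.
  apply: (power_injective_of_der pG) => H sHG expH' x w Hx Hw.
  have [Gx Gw] := (subsetP sHG x Hx, subsetP sHG w Hw).
  have H'c : [~ w, x] \in H^`(1) by apply: mem_commg.
  have Zx : [~ w, x] \in 'Z(G).
    apply: LZ; first exact: groupR.
    by rewrite -[4]/(2 * 2)%N expgM -p2 (expH' _ H'c) expg1n.
  have cZ z : z \in G -> commute z [~ w, x].
    by move=> Gz; case/centerP: Zx => _ cwx; apply/commute_sym/cwx.
  have exw : (x * w) ^+ 2 = x ^+ 2 * w ^+ 2 * [~ w, x].
    by rewrite expMg_Rmul ?bin2 //; apply: cZ.
  have c1 : w ^+ 4 = 1 -> [~ w, x] = 1.
    move=> w4; have /centerP[_ cw] := LZ w Gw w4.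
    by apply/eqP/commgP/cw.
  rewrite p2 exw -mulgA -{2}[x ^+ 2]mulg1 (inj_eq (mulgI _)).
  have w4 : w ^+ 2 = [~ w, x]^-1 -> w ^+ 4 = 1.
    rewrite -[4]/(2 * 2)%N expgM => ->.
    by rewrite expgVn -p2 expH' ?invg1.
  apply/eqP/eqP=> [w2 | w2].
    by rewrite -[RHS]w2 c1 ?mulg1 // w4 //; apply: (mulIg [~ w, x]); rewrite mulVg.
  by rewrite c1 ?mulg1 // -[4]/(2 * 2)%N expgM w2 expg1n.
have defO := Ohm1_power_injective p_pr pG injG.
have nO := char_norm (Ohm_char 1 G).
split=> //; split; first exact: quotient_pgroup.
rewrite (OhmE _ (quotient_pgroup _ pG)) gen_subG p2.
apply/subsetP=> _ /LdivP[/morphimP[x Nx Gx ->]].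
rewrite -morphX //= => /eqP; rewrite (coset_eq1E (groupX _ Nx)) /= defO.
case/LdivP=> _ x8; rewrite -defO.
apply/centerP; split=> [|_ /morphimP[g Ng Gg ->]]; first exact: mem_quotient.
apply/commgP; rewrite -morphR //=.
rewrite (coset_eq1E (subsetP nO _ (groupR Gx Gg))).
rewrite /= defO; apply/LdivP; split; first by rewrite groupR.
apply/eqP; rewrite (power_injective_comm injG) //; apply/commgP.
suffices /centerP[_ cx] : x ^+ p \in 'Z(G) by apply: cx.
apply: LZ; first exact: groupX.
by rewrite -x8 p2 -!expgM.
Qed.

End Families.

(** * Generalised p-central groups *)

Lemma ucnSP (gT : finGroupType) (G : {group gT}) n x :
  reflect (x \in G /\ forall g, g \in G -> [~ x, g] \in 'Z_n(G))
          (x \in 'Z_n.+1(G)).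
Proof.
rewrite ucnSnR inE; apply: (iffP andP) => -[Gx sZ]; split=> //.
  by move=> g Gg; apply: (subsetP sZ); rewrite mem_commg ?set11.
rewrite gen_subG; apply/subsetP=> _ /imset2P[y g /set1P-> Gg ->].
exact: sZ.
Qed.

Lemma lcn_ucn_trivial (gT : finGroupType) (H Q : {group gT}) m n :
  H \subset Q -> 'L_n.+1(H) \subset 'Z_m(Q) -> 'L_(m + n).+1(H) = 1.
Proof.
move=> sHQ; elim: m n => [|m IHm] n sLZ; first exact/trivgP.
rewrite addSnnS; apply: IHm; rewrite lcnSn.
exact: subset_trans (commgSS sLZ sHQ) (ucn_comm _ _).
Qed.

Section GeneralisedCentral.

Variables (p : nat) (p_pr : prime p).

(** The second claim says that [G / 'Z_j(G)] has an injective power map. It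
    comes from the first one, which says that this quotient is again generalised
    [p]-central; and injectivity modulo ['Z_j(G)] turns [x ^+ p \in 'Z_j.+1(G)]
    into [[~ x, g] ^+ p \in 'Z_j(G)], which gives the first claim for [j.+1]. *)
Lemma gen_central_ucn (gT : finGroupType) (G : {group gT}) j :
    2 < p -> p.-group G -> 'Ohm_1(G) \subset 'Z_(p - 2)(G) ->
  {in G, forall x, x ^+ p \in 'Z_j(G) -> x \in 'Z_((p - 2) + j)(G)}
  /\ {in G &, forall x w,
       (x ^- p * (x * w) ^+ p \in 'Z_j(G)) = (w ^+ p \in 'Z_j(G))}.
Proof.
move=> p_gt2 pG ZG.
have AB i : {in G, forall x, x ^+ p \in 'Z_i(G) -> x \in 'Z_((p - 2) + i)(G)} ->
    {in G &, forall x w,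
       (x ^- p * (x * w) ^+ p \in 'Z_i(G)) = (w ^+ p \in 'Z_i(G))}.
  move=> A.
  have injQ : power_injective p (G / 'Z_i(G)).
    apply: (power_injective_of_der (quotient_pgroup _ pG)) => H sHQ expH'.
    apply: power_injective_of_multiplicative.
    apply: (@expgM_small_class _ p_pr p.-1) => //; rewrite prednK ?prime_gt0 //.
    have -> : p = ((p - 2) + 1).+1 by rewrite addn1 -addn2 subnK // ltnW.
    apply: (lcn_ucn_trivial sHQ); rewrite lcn2 -quotient_ucn_add.
    apply/subsetP=> w0 H'w; have wp := expH' _ H'w.
    have /morphimP[v Nv Gv ev] := subsetP sHQ _ (subsetP (der_sub 1 H) _ H'w).
    rewrite ev mem_quotient // A //; apply: coset_idr; rewrite ?groupX //.
    by rewrite morphX //= -ev.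
  move=> x w Gx Gw; have nZ := subsetP (ucn_norm i G).
  have Gxw := groupM Gx Gw.
  have := injQ _ _ (mem_quotient _ Gx) (mem_quotient _ Gw).
  rewrite -morphM ?nZ // -!morphX ?nZ //= eq_sym.
  rewrite (coset_eqE (nZ _ (groupX _ Gx)) (nZ _ (groupX _ Gxw))).
  by rewrite (coset_eq1E (nZ _ (groupX _ Gw))).
elim: j => [|j [IHA IHB]].
  have A0 : {in G, forall x, x ^+ p \in 'Z_0(G) -> x \in 'Z_(p - 2 + 0)(G)}.
    move=> x Gx /set1P x1; rewrite addn0; apply: (subsetP ZG).
    by rewrite (OhmE _ pG) mem_gen //; apply/LdivP.
  by split=> //; apply: AB.
have A1 : {in G, forall x, x ^+ p \in 'Z_j.+1(G) -> x \in 'Z_(p - 2 + j.+1)(G)}.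
  move=> x Gx /ucnSP[_ cx]; rewrite addnS; apply/ucnSP; split=> // g Gg.
  apply: IHA; rewrite ?groupR // -(IHB x) ?groupR //.
  by rewrite -conjg_mulR -conjXg -commgEl cx.
by split=> //; apply: AB.
Qed.

(** To see that [G / 'Ohm_1(G)] is again generalised [p]-central, one shows
    that [x ^+ p \in 'Z_j(G)] puts [x] in the [j]-th centre of that quotient: as
    in [gen_central_ucn], taking a commutator lowers [j]. *)
Lemma power_injective_gen_central k (gT : finGroupType) (G : {group gT}) :
    2 < p -> p.-group G -> 'Ohm_1(G) \subset 'Z_(p - 2)(G) ->
  power_injective (p ^ k) G.
Proof.
move=> p_gt2 pG ZG.
apply: (@power_injective_iter p (fun _ G => p.-group G /\
  'Ohm_1(G) \subset 'Z_(p - 2)(G))) => // {}gT {pG ZG}G [pG ZG].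
have B j := (gen_central_ucn j p_gt2 pG ZG).2.
have injG : power_injective p G.
  move=> x w Gx Gw; have := B 0 x w Gx Gw.
  by rewrite !ucn0 !in_set1 -eq_mulVg1 eq_sym.
have defO := Ohm1_power_injective p_pr pG injG.
have nO := char_norm (Ohm_char 1 G).
split=> //; split; first exact: quotient_pgroup.
have C j : {in G, forall x, x ^+ p \in 'Z_j(G) ->
    coset 'Ohm_1(G) x \in 'Z_j(G / 'Ohm_1(G))}.
  elim: j => [|j IHj] x Gx.
    rewrite !ucn0 !in_set1 => /eqP x1.
    by rewrite coset_id // defO; apply/LdivP.
  case/ucnSP=> _ cx; apply/ucnSP; split=> [|_ /morphimP[g Ng Gg ->]].
    exact: mem_quotient.
  rewrite -morphR ?(subsetP nO) //; apply: IHj; rewrite ?groupR //.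
  by rewrite -(B j x) ?groupR // -conjg_mulR -conjXg -commgEl cx.
apply: (@Ohm1_quotient_sub p _ 'Ohm_1(G)%G _ 'Z_(p - 2)(G / 'Ohm_1(G))%G pG nO).
move=> x Gx Ox; apply: C => //; apply: (subsetP ZG).
exact: Ox.
Qed.

End GeneralisedCentral.

(** * Power filtrations *)

Section PowersModulo.

Variables (gT : finGroupType) (p : nat) (p_pr : prime p).
Implicit Types G N : {group gT}.

(** [expgM_small_class] in the quotient by [N] of the subgroup generated by [x]
    and [w], whose lower central series is dominated by [F]. *)
Lemma expgM_mod G N (F : nat -> {group gT}) x w :
    p.-group G -> G \subset 'N(N) -> (forall n, F n <| G) ->
    (forall n, [~: F n, G] \subset F n.+1) ->
    'Mho^1(F 0) \subset N -> F (p - 2)%N \subset N ->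
    x \in G -> w \in G -> [~ x, w] \in F 0 ->
  (x ^+ p * w ^+ p)^-1 * (x * w) ^+ p \in N.
Proof.
move=> pG nN nF cF sMN sFN Gx Gw Fxw.
pose K := (<[x]> <*> <[w]>)%G.
have sKG : K \subset G by rewrite join_subG !cycle_subG Gx.
have sLF n : 'L_n.+2(K) \subset F n.
  elim: n => [|n IHn].
    by apply: (@commuting_gen_der _ G) => //; apply: normal_norm.
  by rewrite lcnSn; apply: subset_trans (commgSS IHn sKG) (cF n).
have inN := subsetP nN.
have Gxw := groupM Gx Gw.
rewrite -(coset_eqE (inN _ (groupM (groupX _ Gx) (groupX _ Gw))) (inN _ (groupX _ Gxw))).
rewrite morphM ?inN ?groupX // !morphX ?inN // morphM ?inN //= eq_sym.
apply/eqP/(@expgM_small_class _ p_pr p.-1 _ _ (K / N)%G).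
- by rewrite prednK ?prime_gt0.
- rewrite prednK ?prime_gt0 // -[LHS](morphim_lcn (coset_morphism _)); last first.
    exact: subset_trans nN.
  apply/trivgP; rewrite -/(quotient _ _) quotient_sub1.
    by rewrite -(subnK (prime_gt1 p_pr)) addn2 (subset_trans (sLF _)).
 
  exact: subset_trans (lcn_sub _ _) (subset_trans sKG nN).
- move=> v; rewrite -quotient_der ?(subset_trans sKG) // => /morphimP[u Nu K'u ->].
  rewrite -morphX //; apply: coset_id; apply: (subsetP sMN).
  rewrite -[p]expn1; apply: Mho_p_elt; first exact: (subsetP (sLF 0)).
  apply: mem_p_elt pG _; apply: subsetP K'u.
  exact: subset_trans (der_sub _ _) sKG.
- by rewrite mem_quotient // mem_gen // inE cycle_id.
by rewrite mem_quotient // mem_gen // inE cycle_id orbT.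
Qed.

Lemma comm_Mho1_sub G N (A : {group gT}) :
    p.-group A -> A \subset G -> G \subset 'N(N) ->
    (forall t g, t \in A -> g \in G -> [~ t ^+ p, g] \in N) ->
  [~: 'Mho^1(A), G] \subset N.
Proof.
move=> pA sAG nN hyp; have inN := subsetP nN.
have sMG : 'Mho^1(A) \subset G := subset_trans (Mho_sub _ _) sAG.
rewrite -quotient_cents2 ?(subset_trans sMG) // (MhoE _ pA).
rewrite quotient_gen; last first.
  apply: subset_trans nN; rewrite -gen_subG -(MhoE _ pA) //.
rewrite gen_subG; apply/subsetP=> _ /morphimP[_ _ /imsetP[t At ->] ->].
apply/centP=> _ /morphimP[g _ Gg ->]; apply/commgP.
have Gt := subsetP sAG t At.
rewrite expn1 -morphR ?inN ?groupX //= coset_eq1E ?hyp //.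
by rewrite inN // groupR ?groupX.
Qed.

(** Modulo [N] the group [X] equals [[~: X, G]], which nilpotency forbids
    unless it is trivial. *)
Lemma nil_sub_of_joing_comm G N (X : {group gT}) :
    nilpotent G -> G \subset 'N(N) -> X <| G ->
  X \subset N <*> [~: X, G] -> X \subset N.
Proof.
move=> nilG nN /andP[sXG nXG] sX.
rewrite -quotient_sub1 ?(subset_trans sXG) //; apply/trivgP/eqP.
apply: contraTT sX => ntX.
have nXQ : G / N \subset 'N_(G / N)(X / N).
  by rewrite subsetI subxx quotient_norms.
have := nil_comm_properl (quotient_nil N nilG) (quotientS N sXG) ntX nXQ.
move/proper_subn.
rewrite -quotientR //; last exact: subset_trans nN.
apply: contra => sX.
rewrite (subset_trans (quotientS N sX)) // quotientYidl //.
by apply: subset_trans nN; rewrite comm_subG.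
Qed.

End PowersModulo.

(** In additive terms [M i j] is [p ^ j] times the [i]-th term of a
    descending filtration of [G]; the last field says that the [p]-th
    power is additive to first order in the two indices. *)
Record power_filtration (gT : finGroupType) (p : nat) (G : {group gT})
    (M : nat -> nat -> {group gT}) : Prop := PowerFiltration {
  pf_normal : forall i j, M i j <| G;
  pf_top : M 0 0 = G;
  pf_subS : forall i j, M i.+1 j \subset M i j;
  pf_Mho : forall i j, M i j.+1 = 'Mho^1(M i j)%G;
  pf_nil : exists n, forall j, M n j = 1%G;
  pf_expgM : forall i j x w, x \in M 0 j -> w \in M i j ->
    (x ^+ p * w ^+ p)^-1 * (x * w) ^+ p \in M i.+1 j.+1
}.

Section PowerFiltration.

Variables (gT : finGroupType) (p : nat) (p_pr : prime p) (G : {group gT}).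
Variables (pG : p.-group G) (M : nat -> nat -> {group gT}).
Hypothesis fM : power_filtration p G M.

Lemma pf_sub i j : M i j \subset G.
Proof. by have /andP[] := pf_normal fM i j. Qed.

Lemma pf_norm i j : {subset G <= 'N(M i j)}.
Proof. by apply/subsetP; have /andP[] := pf_normal fM i j. Qed.

Lemma pf_sub0 i j : M i j \subset M 0 j.
Proof. by elim: i => // i; apply: subset_trans (pf_subS fM i j). Qed.

Lemma pf_pexp i j x : x \in M i j -> x ^+ p \in M i j.+1.
Proof.
move=> Mx; rewrite (pf_Mho fM) -[p]expn1 Mho_p_elt //.
exact: mem_p_elt pG (subsetP (pf_sub i j) _ Mx).
Qed.

Lemma pf_exp i j x : x \in M i 0 -> x ^+ (p ^ j) \in M i j.
Proof. by move=> Mx; elim: j => [|j IHj] //; rewrite expnSr expgM pf_pexp. Qed.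

(** Induction on [j]: raising [a * b * t], where [t] is the error so far, to
    the power [p] changes [t] into [t ^+ p] up to deeper terms. *)
Lemma pf_expgM_iter i j x w : x \in G -> w \in M i 0 ->
  (x ^+ (p ^ j) * w ^+ (p ^ j))^-1 * (x * w) ^+ (p ^ j) \in M i.+1 j.
Proof.
move=> Gx Mw; elim: j => [|j IHj]; first by rewrite !expg1 mulVg.
have M0x : x ^+ (p ^ j) \in M 0 j by rewrite pf_exp // (pf_top fM).
have Mwj := pf_exp j Mw.
set a := x ^+ (p ^ j) in IHj M0x; set b := w ^+ (p ^ j) in IHj Mwj.
rewrite !expnSr !expgM -/a -/b; rewrite -[(x * w) ^+ _](mulKVg (a * b)).
set t := _^-1 * _ in IHj *; clearbody t a b.
have Mbt : b * t \in M i j by rewrite groupM // (subsetP (pf_subS fM i j)).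
have h1 := pf_expgM fM M0x Mbt.
have h2 := pf_expgM fM (subsetP (pf_sub0 i j) _ Mwj) IHj.
have Mtp := pf_pexp IHj.
have -> : (a ^+ p * b ^+ p)^-1 * (a * b * t) ^+ p
    = t ^+ p * ((b ^+ p * t ^+ p)^-1 * (b * t) ^+ p)
      * ((a ^+ p * (b * t) ^+ p)^-1 * (a * (b * t)) ^+ p).
  by rewrite !invMg -!mulgA !mulKVg.
apply: groupM h1; apply: groupM Mtp _.
exact: subsetP (pf_subS fM _ _) _ h2.
Qed.

(** By [pf_expgM_iter] the elements that are congruent to a [p ^ j]-th power are
    closed under products, and they contain the [p]-th powers that generate
    [M i j]. *)
Lemma pf_repr i j u : u \in M i j ->
  exists2 x, x \in M i 0 & (x ^+ (p ^ j))^-1 * u \in M i.+1 j.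
Proof.
elim: j u => [|j IHj] u Mu; first by exists u; rewrite // expg1 mulVg.
have nM k : {subset M i k <= 'N(M i.+1 k)}.
  by move=> v Mv; apply: pf_norm; apply: subsetP Mv; apply: pf_sub.
pose S := [set v in M i j.+1 |
   [exists x in M i 0, (x ^+ (p ^ j.+1))^-1 * v \in M i.+1 j.+1]].
suffices /subsetP/(_ u Mu): M i j.+1 \subset S.
  by rewrite inE => /andP[_ /exists_inP[x]]; exists x.
have gS : group_set S.
  apply/group_setP; split=> [|v1 v2].
    rewrite inE group1; apply/exists_inP; exists 1; first exact: group1.
    by rewrite expg1n mulg1 invg1.
  rewrite !inE => /andP[Mv1 /exists_inP[x1 Mx1 e1]] /andP[Mv2 /exists_inP[x2 Mx2 e2]].
  rewrite groupM //=; apply/exists_inP; exists (x1 * x2); first exact: groupM.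
  have := pf_expgM_iter j.+1 (subsetP (pf_sub i 0) _ Mx1) Mx2.
  move: e1 e2.
  have [N1 N2] := (nM j.+1 _ (pf_exp j.+1 Mx1), nM j.+1 _ (pf_exp j.+1 Mx2)).
  have N12 := nM j.+1 _ (pf_exp j.+1 (groupM Mx1 Mx2)).
  have [Nv1 Nv2] := (nM _ _ Mv1, nM _ _ Mv2).
  rewrite -(coset_eqE N1 Nv1) -(coset_eqE N2 Nv2) -(coset_eqE N12 (groupM Nv1 Nv2)).
  rewrite -(coset_eqE (groupM N1 N2) N12) => /eqP e1 /eqP e2 /eqP <-.
  by rewrite !morphM //= e1 e2.
rewrite (pf_Mho fM) /= (MhoE _ (pgroupS (pf_sub _ _) pG)).
rewrite (gen_subG _ (Group gS)); apply/subsetP=> _ /imsetP[t Mt ->].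
rewrite expn1 inE pf_pexp //; apply/exists_inP.
have [x Mx Mxt] := IHj t Mt; exists x => //.
have M0x := subsetP (pf_sub0 i j) _ (pf_exp j Mx).
have := pf_expgM fM M0x Mxt; rewrite mulKVg => h.
rewrite expnSr expgM -[t ^+ p](mulKVg (x ^+ (p ^ j) ^+ p * (x ^- (p ^ j) * t) ^+ p)).
rewrite -mulgA mulKg groupM ?pf_pexp //.
exact: subsetP (pf_subS fM _ _) _ h.
Qed.

(** By [pf_repr] the terms [M i e] do not depend on [i], and they end at 1. *)
Lemma pf_trivial e : {in G, forall x, x ^+ (p ^ e) = 1} -> forall i, M i e = 1%G.
Proof.
move=> expG i; apply/val_inj/trivgP.
have [n Mn] := pf_nil fM; rewrite -[[1]]/(gval 1) -(Mn e).
suffices sM k : M i e \subset M (k + i) e.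
  have [lein | /ltnW leni] := leqP i n; first by rewrite -(subnK lein).
  rewrite -(subnK leni); elim: (i - n)%N => // k.
  exact: subset_trans (pf_subS fM _ _).
elim: k => // k IHk; apply: subset_trans IHk _.
apply/subsetP=> u /pf_repr[x Mx]; rewrite expG ?invg1 ?mul1g //.
exact: subsetP (pf_sub _ _) _ Mx.
Qed.

Lemma pf_MhoE j : M 0 j = 'Mho^j(G)%G.
Proof.
apply/val_inj/eqP; rewrite eqEsubset /=; apply/andP; split; last first.
  rewrite (MhoE _ pG) gen_subG; apply/subsetP=> _ /imsetP[x Gx ->].
  by rewrite pf_exp // (pf_top fM).
have [n Mn] := pf_nil fM.
suffices sM k i : n <= k + i -> M i j \subset 'Mho^j(G).
  by apply: (sM n); rewrite addn0.
elim: k i => [|k IHk] i le_n.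
  rewrite add0n in le_n; suffices -> : M i j = 1%G by apply: sub1G.
  apply/val_inj/trivgP; rewrite -[[1]]/(gval 1) -(Mn j) -(subnK le_n).
  elim: (i - n)%N => // k; apply: subset_trans (pf_subS fM _ _).
apply/subsetP=> u /pf_repr[x Mx]; rewrite -[u in X in _ -> X](mulKVg (x ^+ (p ^ j))) => Mu.
have Gx := subsetP (pf_sub _ _) _ Mx.
rewrite groupM //; first by rewrite Mho_p_elt // (mem_p_elt pG).
by apply: (subsetP (IHk i.+1 _)); rewrite ?addnS // -addSn.
Qed.

Lemma pf_power_injective e : (forall j, M 1 j \subset M 0 j.+1) ->
    {in G, forall x, x ^+ (p ^ e.+1) = 1} -> power_injective (p ^ e) G.
Proof.
move=> sM expG; apply: power_injective_of_multiplicative => x y Gx Gy.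
have := pf_expgM_iter e Gx (_ : y \in M 0 0); rewrite (pf_top fM) => /(_ Gy).
move/(subsetP (sM e)); rewrite (pf_trivial expG) => /set1P/eqP.
by rewrite -eq_mulVg1 => /eqP.
Qed.

End PowerFiltration.

(** * Powerful 2-groups and potent groups *)

Definition iter_Mho (gT : finGroupType) j (A : {group gT}) : {group gT} :=
  iter j (fun B : {group gT} => 'Mho^1(B)%G) A.

Section IterMho.

Variable gT : finGroupType.
Implicit Types A B G : {group gT}.

Lemma iter_MhoS j A B : A \subset B -> iter_Mho j A \subset iter_Mho j B.
Proof. by move=> sAB; elim: j => //= j IHj; apply: MhoS. Qed.

Lemma iter_Mho_char j A : iter_Mho j A \char A.
Proof.
by elim: j => [|j IHj] /=; [apply: char_refl | apply: char_trans IHj; apply: Mho_char].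
Qed.

Lemma iter_Mho_normal j A G : A <| G -> iter_Mho j A <| G.
Proof. exact: char_normal_trans (iter_Mho_char j A). Qed.

Lemma iter_Mho_leq m n A : m <= n -> iter_Mho n A \subset iter_Mho m A.
Proof.
move/subnK <-; elim: (n - m)%N => // k; apply: subset_trans.
exact: Mho_sub.
Qed.

Lemma Mho1_proper (p : nat) A : p.-group A -> A :!=: 1 -> 'Mho^1(A) \proper A.
Proof.
move=> pA ntA; apply: sub_proper_trans (Phi_proper ntA).
by rewrite (Phi_joing pA) joing_subr.
Qed.

Lemma iter_Mho_trivial (p : nat) A : p.-group A -> exists n, iter_Mho n A = 1%G.
Proof.
have [n] := ubnP #|A|; elim: n A => // n IHn A; rewrite ltnS => leAn pA.
have [A1 | ntA] := eqVneq A 1%G; first by exists 0.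
have ltM : #|'Mho^1(A)| < n.
  by apply: leq_trans (proper_card _) leAn; apply: (Mho1_proper pA).
have [m Mm] := IHn _ ltM (pgroupS (Mho_sub 1 A) pA).
by exists m.+1; rewrite /iter_Mho iterSr.
Qed.

End IterMho.

Section Powerful2.

Variables (gT : finGroupType) (G : {group gT}).
Hypotheses (pG : 2.-group G) (powG : G^`(1) \subset 'Mho^2(G)).
Let T j := iter_Mho j G.

Let nT j : T j <| G := iter_Mho_normal j (normal_refl G).
Let sT j : T j \subset G := normal_sub (nT j).
Let pT j : 2.-group (T j) := pgroupS (sT j) pG.
Let T2 j x : x \in T j -> x ^+ 2 \in T j.+1.
Proof. by move=> Tx; apply: (Mho_p_elt 1 Tx (mem_p_elt (pT j) Tx)). Qed.

(** Squaring gives [[~ t ^+ 2, g] = c * [~ c, t] * c] for [c = [~ t, g]]; the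
    factor [c ^+ 2] is deep enough, and the remaining commutators are absorbed by
    [nil_sub_of_joing_comm]. *)
Lemma powerful2_comm j : [~: T j, G] \subset T j.+2.
Proof.
elim: j => [|j IHj].
  apply: subset_trans powG _; rewrite (MhoE _ pG) gen_subG.
  apply/subsetP=> _ /imsetP[x Gx ->]; rewrite (expgM x 2 2).
  by do 2!apply: T2.
have nX := commg_normal (T j.+1) G.
apply: (@nil_sub_of_joing_comm _ G (T j.+3) [~: T j.+1, G]%G).
- exact: pgroup_nil pG.
- exact: normal_norm.
- by rewrite /normal normsRr // comm_subG.
set Y := _ <*> _.
have nYG : G \subset 'N(Y).
  by rewrite normsY ?normsRr ?normal_norm.
have sqY d u : d \in T j.+2 -> [~ d, u] \in Y -> u \in G -> d * [~ d, u] * d \in Y.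
  move=> Td Ydu Gu; have Gd := subsetP (sT _) _ Td.
  have Yd : d ^+ 2 \in Y by apply: (subsetP (joing_subl _ _)); apply: T2.
  rewrite -mulgA (conjgC [~ d, u]) mulgA groupM //.
  by rewrite memJ_norm // (subsetP nYG).
have sTY : [~: T j.+2, G] \subset Y.
  apply: (@comm_Mho1_sub _ 2 G Y%G (T j.+1)) => // u g Tu Gg.
  have Gu := subsetP (sT _) _ Tu.
  have Xd : [~ u, g] \in [~: T j.+1, G] by rewrite mem_commg.
  rewrite expgS expg1 commMgR; apply: sqY => //.
    apply: subsetP Xd; apply: subset_trans (commSg _ _) IHj.
    exact: Mho_sub.
  by rewrite mem_gen // inE mem_commg ?orbT.
apply: (@comm_Mho1_sub _ 2 G Y%G (T j)) => // t g Tt Gg.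
rewrite expgS expg1 commMgR; have Gt := subsetP (sT _) _ Tt.
have Tc : [~ t, g] \in T j.+2 by apply: (subsetP IHj); rewrite mem_commg.
by apply: sqY => //; apply: (subsetP sTY); rewrite mem_commg.
Qed.

(** The series [T] serves itself as the filtration, so that both indices count
    squarings. *)
Lemma powerful2_filtration : power_filtration 2 G (fun i j => T (i + j)).
Proof.
have nilG := pgroup_nil pG.
split=> //.
- by move=> i j; apply: Mho_sub.
- by move=> i j; rewrite addnS.
- have [n Tn] := iter_Mho_trivial pG; exists n => j; apply/val_inj/trivgP.
  by rewrite -[[1]]/(gval 1) -Tn iter_Mho_leq ?leq_addr.
move=> i j x w Tx Tw.
have nT' n := normal_norm (nT n).
have [Gx Gw] := (subsetP (sT _) _ Tx, subsetP (sT _) _ Tw).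
apply: (@expgM_mod _ _ _ G (T (i.+1 + j.+1)) (fun _ => T (i.+1 + j.+1))) => //.
- by move=> n; rewrite commg_subl.
- exact: Mho_sub.
rewrite -groupV invg_comm addSn addnS; apply: (subsetP (powerful2_comm _)).
by rewrite mem_commg.
Qed.

End Powerful2.

Section Potent.

Variables (gT : finGroupType) (p : nat) (G : {group gT}).
Hypotheses (p_pr : prime p) (p_gt2 : 2 < p) (pG : p.-group G).
Hypothesis potG : 'L_(p - 1)(G) \subset 'Mho^1(G).

Let L i := 'L_i(G)%G.
Let M i j := iter_Mho j (L i.+1).

Let nL i : L i <| G := lcn_normal i G.
Let nM i j : M i j <| G := iter_Mho_normal j (nL _).
Let sM i j : M i j \subset G := normal_sub (nM i j).
Let pM i j : p.-group (M i j) := pgroupS (sM i j) pG.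
Let Mp i j x : x \in M i j -> x ^+ p \in M i j.+1.
Proof. by move=> Mx; apply: (Mho_p_elt 1 Mx (mem_p_elt (pM i j) Mx)). Qed.

Let ep : (p - 2).+2 = p.
Proof. by rewrite -addn2 subnK // ltnW. Qed.

(** The inclusion ['L_(i + p - 1)(G) \subset M i 1], which is the hypothesis
    for [i = 0], and the commutator bound propagate each other: the first makes
    the weight [p] term of the power formula negligible in the second, and
    commuting the first with [G] gives it for [i.+1]. *)
Lemma potent_comm i :
  'L_(i + (p - 2)).+1(G) \subset M i 1 /\ [~: M i 1, G] \subset M i.+1 1.
Proof.
have step k : 'L_(k + (p - 2)).+1(G) \subset M k 1 -> [~: M k 1, G] \subset M k.+1 1.
  move=> sLM; have nX := commg_normal (M k 1) G.
  apply: (@nil_sub_of_joing_comm _ G (M k.+1 1) [~: M k 1, G]%G).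
  - exact: pgroup_nil pG.
  - exact: normal_norm.
  - by rewrite /normal normsRr // comm_subG.
  set Y := _ <*> _.
  have nYG : G \subset 'N(Y) by rewrite normsY ?normsRr ?normal_norm.
  apply: (@comm_Mho1_sub _ p G Y%G (M k 0)) => // t g Mt Gg.
  have Gt := subsetP (sM _ _) _ Mt.
  have Mc : [~ t, g] \in M k.+1 0 by rewrite /M /= lcnSn mem_commg.
  have Gc := subsetP (sM _ _) _ Mc.
  have Ycp : [~ t, g] ^+ p \in Y by apply: (subsetP (joing_subl _ _)); apply: Mp.
  rewrite commgEl conjXg conjg_mulR -[X in _ * X](mulKVg (t ^+ p * [~ t, g] ^+ p)).
  rewrite -!mulgA mulKg groupM //.
  apply: (@expgM_mod _ _ p_pr G Y%G (fun n => M (k.+2 + n) 0)) => //.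
  - by move=> n; rewrite addnS /M /= lcnSn.
  - rewrite addn0; apply: subset_trans (joing_subl _ _).
    exact: MhoS (lcn_subS _ _).
  - rewrite /M /= !addSn !lcnSn; apply: subset_trans (joing_subr _ _).
    by rewrite !commgSS.
  by rewrite addn0 -groupV invg_comm /M /= lcnSn mem_commg.
suffices sLM k : 'L_(k + (p - 2)).+1(G) \subset M k 1 by split; last exact: step.
elim: k => [|k IHk].
  have -> : (0 + (p - 2)).+1 = (p - 1)%N by rewrite add0n -(subSn (ltnW p_gt2)) subSS.
  exact: potG.
by rewrite addSn lcnSn; apply: subset_trans (commSg _ IHk) (step _ IHk).
Qed.

Let sMS i j : M i.+1 j \subset M i j.
Proof. by apply: iter_MhoS; apply: lcn_subS. Qed.

Lemma potent_shift i j : M (i + (p - 2)) j \subset M i j.+1.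
Proof.
have [sLM _] := potent_comm i.
by rewrite [M i j.+1]/(iter_Mho j.+1 _) /iter_Mho iterSr; apply: iter_MhoS.
Qed.

(** Commutators of weight [p] in [x] and [w] lie in [M (i + (p - 2)) j], which
    [potent_shift] puts among the [p]-th powers. *)
Lemma potent_expgM i j x w :
    (forall k, [~: M k j, G] \subset M k.+1 j) ->
    x \in G -> w \in G -> [~ x, w] \in M i j ->
  (x ^+ p * w ^+ p)^-1 * (x * w) ^+ p \in M i j.+1.
Proof.
move=> cM Gx Gw Mxw.
apply: (@expgM_mod _ _ p_pr G _ (fun n => M (i + n) j)) => //.
- exact: normal_norm.
- by move=> n; rewrite addnS.
- by rewrite addn0.
- exact: potent_shift.
by rewrite addn0.
Qed.

(** [[~ t ^+ p, g]] is [t ^- p * (t * c) ^+ p] with [c = [~ t, g]], hence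
    [c ^+ p] up to deeper terms. *)
Lemma potent_comm_iter i j : [~: M i j, G] \subset M i.+1 j.
Proof.
elim: j i => [|j IHj] i; first by rewrite /M /= -lcnSn.
apply: (@comm_Mho1_sub _ p G (M i.+1 j.+1) (M i j)) => // [|t g Mt Gg].
  exact: normal_norm.
have Gt := subsetP (sM _ _) _ Mt.
have Mc : [~ t, g] \in M i.+1 j by apply: (subsetP (IHj i)); rewrite mem_commg.
have Gc := subsetP (sM _ _) _ Mc.
rewrite commgEl conjXg conjg_mulR -[X in _ * X](mulKVg (t ^+ p * [~ t, g] ^+ p)).
rewrite -!mulgA mulKg groupM ?Mp //.
apply: potent_expgM => //; apply: (subsetP (sMS _ _)).
by rewrite -groupV invg_comm; apply: (subsetP (IHj _)); rewrite mem_commg.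
Qed.

Lemma potent_filtration : power_filtration p G M.
Proof.
split=> //.
- exact: val_inj.
- have [n Ln] := lcnP _ (pgroup_nil pG).
  exists n => j; apply/val_inj/trivgP.
  by rewrite -[[1]]/(gval 1) /M; elim: j => [|j IHj]; rewrite /= ?Ln //
     (subset_trans (Mho_sub _ _)).
move=> i j x w Mx Mw; have [Gx Gw] := (subsetP (sM _ _) _ Mx, subsetP (sM _ _) _ Mw).
apply: potent_expgM => // [k|]; first exact: potent_comm_iter.
rewrite -groupV invg_comm; apply: (subsetP (potent_comm_iter _ _)).
by rewrite mem_commg.
Qed.

End Potent.

(** * Two-generator groups modulo the Frattini subgroup *)

Lemma mem_coprime_exp (gT : finGroupType) (p : nat) (H : {group gT}) x i :
  prime p -> p.-elt x -> ~~ (p %| i) -> x ^+ i \in H -> x \in H.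
Proof.
move=> p_pr p_x npi Hxi.
have: generator <[x]> (x ^+ i).
  rewrite generator_coprime; apply: (pnat_coprime p_x).
  by rewrite p'natE.
by rewrite /generator => /eqP defx; rewrite -cycle_subG defx cycle_subG.
Qed.

Section Frattini.

Variables (gT : finGroupType) (p : nat) (p_pr : prime p) (G : {group gT}).
Hypothesis pG : p.-group G.

Local Notation Phi := 'Phi(G).
Local Notation pi := (coset Phi).

Lemma norm_Phi x : x \in G -> x \in 'N(Phi).
Proof. exact: subsetP (normal_norm (Phi_normal G)) x. Qed.

Lemma pi_commute x y : x \in G -> y \in G -> commute (pi x) (pi y).
Proof.
move=> Gx Gy; have /abelem_abelian/centsP cQ := Phi_quotient_abelem pG.
by apply: cQ; apply: mem_quotient.
Qed.

Lemma pi_expp x : x \in G -> pi x ^+ p = 1.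
Proof.
move=> Gx; have /(abelemP p_pr)[_ -> //] := Phi_quotient_abelem pG.
exact: mem_quotient.
Qed.

Lemma pi_exp_mod x i : x \in G -> pi x ^+ i = pi x ^+ (i %% p).
Proof. by move=> Gx; rewrite expg_mod // pi_expp. Qed.

Lemma cyclic_of_line (c : gT) (A : {set gT}) :
  c \in G -> {subset A <= G} -> <<A>> = G -> {in A, forall x, pi x \in <[pi c]>} -> cyclic G.
Proof.
move=> Gc sAG defG lA; apply: Phi_quotient_cyclic.
suffices -> : G / Phi = <[pi c]> by apply: cycle_cyclic.
apply/eqP; rewrite eqEsubset cycle_subG mem_quotient // andbT.
have sAN : A \subset 'N(Phi) by apply/subsetP=> x /sAG/norm_Phi.
have -> : G / Phi = <<A / Phi>> by rewrite -quotient_gen // defG.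
rewrite gen_subG.
by apply/subsetP=> _ /morphimP[x Nx Ax ->]; apply: lA.
Qed.

Section TwoGenerators.

Variables x y : gT.
Hypothesis genG : <<[set x; y]>> = G.

Lemma gen2l : x \in G. Proof. by rewrite -genG mem_gen ?set21. Qed.
Lemma gen2r : y \in G. Proof. by rewrite -genG mem_gen ?set22. Qed.
Let Gx := gen2l.
Let Gy := gen2r.

Lemma pi_repr v : v \in G -> exists i j, pi v = pi x ^+ i * pi y ^+ j.
Proof.
move=> Gv; have: pi v \in G / Phi by apply: mem_quotient.
have sN : [set x; y] \subset 'N(Phi) by apply/subsetP=> t /set2P[]->; apply: norm_Phi.
have -> : G / Phi = <<[set x; y] / Phi>> by rewrite -quotient_gen // genG.
rewrite /quotient morphimU !morphim_set1 ?norm_Phi //=.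
rewrite -joingE -(joing_idl [set _]) -(joing_idr _ [set _]).
rewrite -/(cycle (pi x)) -/(cycle (pi y)).
rewrite cent_joinEr; last first.
  rewrite cent_cycle cycle_subG; apply/cent1P; exact: pi_commute.
by case/mulsgP=> _ _ /cycleP[i ->] /cycleP[j ->] ->; exists i, j.
Qed.

(** If the exponents of [x] differed modulo [p], then [x] would lie on the line
    of [y] and [G] would be cyclic. *)
Lemma pi_indep m n m' n' : ~~ cyclic G ->
  pi x ^+ m * pi y ^+ n = pi x ^+ m' * pi y ^+ n' -> m = m' %[mod p].
Proof.
move=> ncG; wlog le_m: m n m' n' / m' <= m.
  move=> IH; case/orP: (leq_total m m') => le e.
    exact/esym/(IH m' n' m n).
  exact: (IH m n m' n').
move=> e; apply/eqP; rewrite eqn_mod_dvd //; apply: contraNT ncG => npi.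
apply: (@cyclic_of_line y [set x; y]) => // [t /set2P[]-> // | t /set2P[]->];
  last exact: cycle_id.
have : pi x ^+ (m - m') \in <[pi y]>.
  have -> : pi x ^+ (m - m') = pi y ^+ n' * pi y ^- n.
    apply: (mulIg (pi y ^+ n)); rewrite mulgKV; apply: (mulgI (pi x ^+ m')).
    by rewrite mulgA -expgD subnKC.
  by rewrite groupM ?groupV ?mem_cycle.
apply: (@mem_coprime_exp _ p <[pi y]>%G) => //.
exact: mem_p_elt (quotient_pgroup 'Phi(G) pG) (mem_quotient _ Gx).
Qed.

Lemma gen_of_pi (A : {set gT}) : {subset A <= G} ->
  pi x \in <<A / Phi>> -> pi y \in <<A / Phi>> -> <<A>> = G.
Proof.
move=> /subsetP sAG Ax Ay; have nPhi := normal_norm (Phi_normal G).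
have sAN := subset_trans sAG nPhi.
apply: Phi_nongen; rewrite -joing_idr; apply/eqP.
rewrite eqEsubset join_subG Phi_sub gen_subG sAG /=.
rewrite norm_joinEr ?gen_subG // -quotientSK // quotient_gen //.
have -> : G / Phi = <<[set x; y] / Phi>>.
  by rewrite -quotient_gen ?genG //; apply/subsetP=> t /set2P[]->; apply: norm_Phi.
rewrite gen_subG /quotient morphimU !morphim_set1 ?norm_Phi //=.
by rewrite subUset !sub1set Ax.
Qed.

Lemma complete_generator a : a \in G -> a \notin Phi ->
  exists2 c, c \in G & <<[set a; c]>> = G.
Proof.
move=> Ga nPa; have [i [j ea]] := pi_repr Ga.
have piA c : c \in G -> pi a \in <<[set a; c] / Phi>> /\ pi c \in <<[set a; c] / Phi>>.
  by move=> Gc; split; apply: mem_gen; apply: mem_morphim; rewrite ?norm_Phi ?set21 ?set22.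
have sA c : c \in G -> {subset [set a; c] <= G} by move=> Gc t /set2P[]->.
have pQ t : t \in G -> p.-elt (pi t).
  by move=> Gt; apply: mem_p_elt (quotient_pgroup 'Phi(G) pG) (mem_quotient _ Gt).
have [dvd_i | ndvd_i] := boolP (p %| i); last first.
  exists y => //; have [Aa Ay] := piA y Gy; apply: (gen_of_pi (sA _ Gy) _ Ay).
  apply: (mem_coprime_exp p_pr (pQ x Gx) ndvd_i).
  by rewrite -(mulgK (pi y ^+ j) (pi x ^+ i)) -ea groupM ?groupV ?groupX.
have [dvd_j | ndvd_j] := boolP (p %| j).
  case/negP: nPa; apply: coset_idr; first exact: norm_Phi.
  rewrite ea (pi_exp_mod i Gx) (pi_exp_mod j Gy).
  by rewrite (eqP dvd_i) (eqP dvd_j) mulg1.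
exists x => //; have [Aa Ax] := piA x Gx; apply: (gen_of_pi (sA _ Gx) Ax).
apply: (mem_coprime_exp p_pr (pQ y Gy) ndvd_j).
by rewrite -(mulKg (pi x ^+ i) (pi y ^+ j)) -ea groupM ?groupV ?groupX.
Qed.

(** Among the [p + 1 <= 4] lines of [G / 'Phi(G)], at most the line of
    [x * y ^+ 2] avoids the triple [x, y, x * y]. *)
Lemma lines_small v : p < 5 -> v \in G ->
  (exists a k, a \in [:: x; y; x * y] /\ pi v = pi (a ^+ k)) \/
  pi v \in <[pi (x * y ^+ 2)]>.
Proof.
move=> p_lt5 Gv; have [i [j ev]] := pi_repr Gv.
have {}p_lt5 : p = 2 \/ p = 3.
  by move: p_pr p_lt5; case: (p) => [|[|[|[|[|]]]]] //; [left | right].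
rewrite (pi_exp_mod i Gx) (pi_exp_mod j Gy) in ev.
have := ltn_pmod i (prime_gt0 p_pr); have := ltn_pmod j (prime_gt0 p_pr).
move: (i %% p) (j %% p) ev => {}i {}j.
have cxy := pi_commute Gx Gy.
have xp := pi_expp Gx; have yp := pi_expp Gy.
have Nx := norm_Phi Gx; have Ny := norm_Phi Gy.
case: j => [|j] ev.
  by left; exists x, i; rewrite mem_head morphX // ev mulg1.
case: i ev => [|i] ev.
  by left; exists y, j.+1; rewrite !inE eqxx orbT morphX // ev mul1g.
move=> ltj lti; have [eij | neij] := eqVneq i j.
  left; exists (x * y), i.+1; rewrite !inE eqxx !orbT morphX ?groupM //.
  by rewrite morphM //= expgMn // ev eij.
have p3 : p = 3 by lia.
right; have -> : pi (x * y ^+ 2) = pi x * pi y ^+ 2.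
  by rewrite morphM ?morphX ?groupX.
have [[ei ej] | [ei ej]] : (i = 0 /\ j = 1)%N \/ (i = 1 /\ j = 0)%N by lia.
  by rewrite ev ei ej cycle_id.
rewrite ev ei ej; apply/cycleP; exists 2; rewrite expgMn; last exact: commuteX.
by rewrite -expgM -[(2 * 2)%N]/(3 + 1)%N expgD -[in X in _ * (X * _)]p3 yp mul1g.
Qed.

End TwoGenerators.
End Frattini.

(** * A criterion for Beauville groups *)

Lemma SigmaP (gT : finGroupType) (G : {group gT}) x y s :
  reflect (exists g a k, [/\ g \in G, a \in [:: x; y; x * y] & s = (a ^+ k) ^ g])
          (s \in Sigma G x y).
Proof.
apply: (iffP bigcupP) => [[g Gg] | [g [a [k [Gg Ta ->]]]]].
  rewrite !inE -orbA => /or3P[] /imsetP[_ /cycleP[k ->] ->].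
  - by exists g, x, k; rewrite mem_head.
  - by exists g, y, k; rewrite !inE eqxx orbT.
  - by exists g, (x * y), k; rewrite !inE eqxx !orbT.
exists g => //; rewrite !inE !memJ_conjg.
by move: Ta; rewrite !inE => /or3P[] /eqP->; rewrite mem_cycle ?orbT.
Qed.

Lemma commute_mul_exps (gT : finGroupType) (u v : gT) i j k l : commute u v ->
  (u ^+ i * v ^+ j) * (u ^+ k * v ^+ l) = u ^+ (i + k) * v ^+ (j + l).
Proof.
move=> cuv; rewrite !expgD !mulgA; congr (_ * _); rewrite -!mulgA; congr (_ * _).
by apply: commuteX; apply/commute_sym/commuteX.
Qed.

Section Criterion.

Variables (gT : finGroupType) (p n : nat) (p_pr : prime p) (G : {group gT}).
Hypotheses (pG : p.-group G) (expG : exponent G = (p ^ n.+1)%N).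

Local Notation q := (p ^ n)%N.
Local Notation Phi := 'Phi(G).
Local Notation pi := (coset 'Phi(G)).

Lemma exp_q_p x : x \in G -> (x ^+ q) ^+ p = 1.
Proof. by move=> Gx; rewrite -expgM -expnSr -expG expg_exponent. Qed.

Lemma exists_exp_q_neq1 : exists2 x, x \in G & x ^+ q != 1.
Proof.
apply/exists_inP; apply: contraT; rewrite negb_exists_in => /forall_inP h.
have: exponent G %| q.
  by apply/exponentP=> x Gx; apply/eqP; rewrite -[_ == _]negbK h.
by rewrite expG dvdn_Pexp2l ?prime_gt1 // ltnn.
Qed.

Lemma exp_q_Mho x : x \in G -> x ^+ q \in 'Mho^n(G).
Proof. by move=> Gx; apply: Mho_p_elt Gx (mem_p_elt pG Gx). Qed.

(** An element [c ^+ q] has order dividing [p]. *)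
Lemma Mho_not_cycle c : c \in G -> (p ^ 2 <= #|'Mho^n(G)|)%N ->
  ~~ ('Mho^n(G) \subset <[c ^+ q]>).
Proof.
move=> Gc leM; apply: contraL leM => sM; rewrite -ltnNge.
apply: leq_ltn_trans (subset_leq_card sM) _.
apply: leq_ltn_trans (_ : p < _); last by rewrite -{1}[p]expn1 ltn_exp2l ?prime_gt1.
by rewrite dvdn_leq ?prime_gt0 // -orderE order_dvdn exp_q_p.
Qed.

Lemma noncyclic_of_Mho : (p ^ 2 <= #|'Mho^n(G)|)%N -> ~~ cyclic G.
Proof.
move=> leM; apply/negP=> /cyclicP[c defG].
have Gc : c \in G by rewrite defG cycle_id.
case/negP: (Mho_not_cycle Gc leM); rewrite (MhoE _ pG) gen_subG.
apply/subsetP=> _ /imsetP[x + ->]; rewrite defG => /cycleP[i ->].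
by rewrite -expgM mulnC expgM mem_cycle.
Qed.

Hypothesis gen2 : two_generator G.

Hypothesis kerH : exists2 K : {group gT}, K \proper G &
  {in G, forall x, x ^+ q = 1 -> x \in K}.
Hypothesis injH : (p ^ 2 <= #|'Mho^n(G)|)%N ->
  {in G &, forall a b, a \notin Phi -> a ^+ q = b ^+ q -> pi a = pi b}.
Hypothesis conjH : p < 5 -> (p ^ 2 <= #|'Mho^n(G)|)%N ->
  {in G &, forall a b, a \notin Phi -> pi a = pi b ->
     exists2 g, g \in G & b ^+ q = (a ^+ q) ^ g}.

Lemma exp_q_neq1 a : (p ^ 2 <= #|'Mho^n(G)|)%N -> a \in G -> a \notin Phi -> a ^+ q != 1.
Proof.
move=> leM Ga nPa; apply/eqP=> a1; case/negP: (nPa).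
apply: coset_idr; first exact: norm_Phi.
by rewrite (injH leM Ga (group1 G) nPa) ?morph1 // expg1n.
Qed.

(** If ['Mho^n(G)] has order at most [p], it is generated by any nontrivial
    [q]-th power; a generating set is not contained in the proper subgroup
    [kerH], so each of the two [Sigma] sets contains such a power. *)
Lemma Beauville_Mho x1 y1 x2 y2 :
  Beauville_structure G x1 y1 x2 y2 -> (p ^ 2 <= #|'Mho^n(G)|)%N.
Proof.
case=> gen_1 gen_2 tiS; rewrite leqNgt; apply/negP=> ltM.
have [K prK hK] := kerH.
have full x y : <<[set x; y]>> = G -> exists2 a, a \in [set x; y] & a ^+ q != 1.
  move=> genG; apply/exists_inP; apply: contraT; rewrite negb_exists_in => /forall_inP h.
  case/negP: (proper_subn prK); rewrite -genG gen_subG.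
  apply/subsetP=> a Aa; apply: hK; first by rewrite -genG mem_gen.
  by apply/eqP; rewrite -[_ == _]negbK h.
have [[a Aa na] [b Bb nb]] := (full _ _ gen_1, full _ _ gen_2).
have Ga : a \in G by rewrite -gen_1 mem_gen.
have Gb : b \in G by rewrite -gen_2 mem_gen.
have defM c : c \in G -> c ^+ q != 1 -> 'Mho^n(G) = <[c ^+ q]>.
  move=> Gc nc; apply/esym/eqP; rewrite eqEcard cycle_subG exp_q_Mho //=.
  have oc : #[c ^+ q] = p.
    by apply/nt_prime_order => //; apply: exp_q_p.
  rewrite -orderE oc; have /p_natP[k ek] := pgroupS (Mho_sub n G) pG.
  by move: ltM; rewrite ek ltn_exp2l ?prime_gt1 // -{2}[p]expn1 leq_exp2l ?prime_gt1.
case/negP: na; rewrite -in_set1 -[[set 1]]tiS inE; apply/andP; split; apply/SigmaP.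
  exists 1, a, q; rewrite conjg1 group1; split=> //.
  by move: Aa; rewrite !inE => /orP[] ->; rewrite ?orbT.
have /cycleP[k ->] : a ^+ q \in <[b ^+ q]> by rewrite -defM ?exp_q_Mho.
exists 1, b, (q * k)%N; rewrite conjg1 group1 expgM; split=> //.
by move: Bb; rewrite !inE => /orP[] ->; rewrite ?orbT.
Qed.

(** Two generators cannot both lie on the one line that the other triple
    avoids, so some [b] of the second triple is congruent to a power of some [a]
    of the first; their [q]-th powers are then conjugate. *)
Lemma Beauville_ge5 x1 y1 x2 y2 :
  Beauville_structure G x1 y1 x2 y2 -> 5 <= p.
Proof.
move=> bG; have leM := Beauville_Mho bG; case: bG => gen_1 gen_2 tiS.
rewrite leqNgt; apply/negP=> p_lt5.
have ncG := noncyclic_of_Mho leM.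
have [Gx1 Gy1] := (gen2l gen_1, gen2r gen_1).
have [Gx2 Gy2] := (gen2l gen_2, gen2r gen_2).
pose c := x1 * y1 ^+ 2; have Gc : c \in G by rewrite groupM ?groupX.
have [b [Bb nPb [a [k [Aa eab]]]]] : exists b, [/\ b \in [set x2; y2], b \notin Phi &
    exists a k, a \in [:: x1; y1; x1 * y1] /\ pi b = pi (a ^+ k)].
  have nPb b : b \in [set x2; y2] -> b \notin Phi.
    move=> Bb; apply: contra ncG => Pb.
    have line t : t \in G -> {in [set x2; y2], forall u, u \in [set b; t]} -> cyclic G.
      move=> Gt sub; apply: (cyclic_of_line Gt _ gen_2) => u Au.
        by move: Au => /set2P[]->.
      case/set2P: (sub u Au) => ->; last exact: cycle_id.
      by rewrite coset_id ?group1.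
    case/set2P: Bb line => ebb line; rewrite {}ebb in line.
      by apply: (line y2).
    by apply: (line x2) => // u; rewrite !inE orbC.
  have [h | cx] := lines_small p_pr pG gen_1 p_lt5 Gx2.
    by exists x2; rewrite set21 nPb ?set21.
  have [h | cy] := lines_small p_pr pG gen_1 p_lt5 Gy2.
    by exists y2; rewrite set22 nPb ?set22.
  case/negP: ncG; apply: (cyclic_of_line Gc _ gen_2) => t /set2P[]-> //.
have Ga : a \in G by move: Aa; rewrite !inE => /or3P[] /eqP-> //; rewrite groupM.
have Gb : b \in G by move: Bb => /set2P[]->.
have nPa : a ^+ k \notin Phi.
  apply: contra nPb => Pa; apply: coset_idr; first exact: norm_Phi.
  by rewrite eab coset_id.
have [g Gg eb] := conjH p_lt5 leM (groupX k Ga) Gb nPa (esym eab).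
case/negP: (exp_q_neq1 leM Gb nPb).
rewrite -in_set1 -[[set 1]]tiS inE; apply/andP; split; apply/SigmaP.
  by exists g, a, (k * q)%N; rewrite expgM.
exists 1, b, q; rewrite conjg1 group1; split=> //.
by move: Bb; rewrite !inE => /orP[] ->; rewrite ?orbT.
Qed.

Lemma pi_conj u g : u \in G -> g \in G -> pi (u ^ g) = pi u.
Proof.
move=> Gu Gg; rewrite conjg_mulR morphM ?norm_Phi ?groupR //.
rewrite morphR ?norm_Phi //=; have /commgP/eqP-> := pi_commute pG Gu Gg.
by rewrite mulg1.
Qed.

Lemma expg_order_p a k : a \in G -> a ^+ q != 1 -> (a ^+ k) ^+ p = 1 ->
  exists i, k = (i * q)%N.
Proof.
move=> Ga na; rewrite -expgM => /eqP; rewrite -order_dvdn => dvd_a.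
suffices oa : #[a] = (p * q)%N.
  by apply/dvdnP; rewrite -(dvdn_pmul2r (prime_gt0 p_pr)) mulnC -oa.
have : #[a] %| p ^ n.+1 by rewrite order_dvdn expnSr expgM exp_q_p.
case/(dvdn_pfactor _ _ p_pr) => m le_m oa; rewrite oa -expnS; congr (_ ^ _)%N.
apply/eqP; rewrite eqn_leq le_m ltnNge; apply: contra na => le_mn.
by rewrite -order_dvdn oa dvdn_exp2l.
Qed.

(** Cramer's rule modulo [p] for the homogeneous system with coefficient vectors
    [(a, b)] and [(c, d)], whose determinant is [e] up to sign. *)
Lemma slopes_indep i j a b c d e : 5 <= p -> e \in [:: 1; 2; 3; 4; 6]%N ->
    (a * d = b * c + e \/ b * c = a * d + e)%N ->
    i * a = j * c %[mod p] -> i * b = j * d %[mod p] ->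
  (p %| i) /\ (p %| j).
Proof.
move=> p_ge5 se det ea eb.
have npe : ~~ (p %| e).
  apply/negP=> /dvdnP[k ek]; move: p_pr p_ge5 se; rewrite {}ek {ea eb}.
  rewrite !inE; case: k => [|[|k]] pr ge5; rewrite ?mulSn ?mul0n; [lia | | lia].
  move=> se; have p6 : p = 6%N by lia.
  by move: pr; rewrite p6.
have ei : i * (a * d) = i * (b * c) %[mod p].
  by rewrite !mulnA -modnMml ea modnMml -(modnMml (i * b)) eb modnMml mulnAC.
have ej : j * (a * d) = j * (b * c) %[mod p].
  rewrite (mulnC a) (mulnC b) !mulnA.
  by rewrite -(modnMml (j * d)) -eb modnMml -(modnMml (j * c)) -ea modnMml mulnAC.
have fin t : t * (a * d) = t * (b * c) %[mod p] -> p %| t.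
  case: det => -> /eqP; rewrite mulnDr; last rewrite eq_sym.
    rewrite eqn_mod_dvd ?leq_addr // addKn Euclid_dvdM //.
    by rewrite (negbTE npe) orbF.
  rewrite eqn_mod_dvd ?leq_addr // addKn Euclid_dvdM //.
  by rewrite (negbTE npe) orbF.
by split; apply: fin.
Qed.

(** The slopes are 0, 1 and infinity for [x, y, x * y], and 2, 4 and 3 for
    [u = x * y ^+ 2], [v = x * y ^+ 4] and [u * v]; they are distinct modulo any
    prime [p >= 5]. *)
Lemma Beauville_of_Mho : 5 <= p -> (p ^ 2 <= #|'Mho^n(G)|)%N -> Beauville G.
Proof.
move=> p_ge5 leM; have ncG := noncyclic_of_Mho leM.
have [x [y genG]] := gen2; have [Gx Gy] := (gen2l genG, gen2r genG).
have genG' : <<[set y; x]>> = G by rewrite setUC.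
pose u := x * y ^+ 2; pose v := x * y ^+ 4.
have [Gu Gv] : u \in G /\ v \in G by rewrite !groupM ?groupX.
have genuv : <<[set u; v]>> = G.
  apply/eqP; rewrite eqEsubset gen_subG; apply/andP; split.
    by apply/subsetP=> t /set2P[]->.
  have Hu : u \in <<[set u; v]>> by rewrite mem_gen ?set21.
  have Hv : v \in <<[set u; v]>> by rewrite mem_gen ?set22.
  have Hy : y \in <<[set u; v]>>.
    apply: (@mem_coprime_exp _ _ _ y 2 p_pr (mem_p_elt pG Gy)).
      by rewrite gtnNdvd // (leq_trans _ p_ge5).
    have -> : y ^+ 2 = u^-1 * v.
      by rewrite /u /v invMg -mulgA mulKg (expgD y 2 2) mulKg.
    exact: groupM (groupVr Hu) Hv.
  have Hx : x \in <<[set u; v]>>.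
    by rewrite -(mulgK (y ^+ 2) x); apply: groupM Hu _; rewrite groupV groupX.
  by rewrite -genG gen_subG; apply/subsetP=> t /set2P[]->.
have key a b i j : a \in [:: x; y; x * y] -> b \in [:: u; v; u * v] ->
    pi a ^+ i = pi b ^+ j -> (p %| i) /\ (p %| j).
  move=> Ta Tb; have cxy := pi_commute pG Gx Gy.
  have cX k l : commute (pi x ^+ k) (pi y ^+ l) by apply/commuteX/commute_sym/commuteX.
  have [coefa coefb] : (exists A B, pi a = pi x ^+ A * pi y ^+ B /\
       (A, B) \in [:: (1, 0); (0, 1); (1, 1)]%N)
     /\ (exists C D, pi b = pi x ^+ C * pi y ^+ D /\
       (C, D) \in [:: (1, 2); (1, 4); (2, 6)]%N).
    have pi_y k : pi (x * y ^+ k) = pi x ^+ 1 * pi y ^+ k.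
      by rewrite morphM ?morphX ?norm_Phi ?groupX.
    split.
      move: Ta; rewrite !inE => /or3P[] /eqP->.
      - by exists 1%N, 0; rewrite mulg1.
      - by exists 0, 1%N; rewrite mul1g.
      by exists 1%N, 1%N; rewrite -(pi_y 1%N).
    move: Tb; rewrite !inE => /or3P[] /eqP->.
    - by exists 1%N, 2; rewrite pi_y.
    - by exists 1%N, 4; rewrite pi_y.
    exists 2, 6; rewrite morphM ?norm_Phi //= !pi_y; split=> //.
    exact: commute_mul_exps.
  have [A [B [ea sAB]]] := coefa; have [C [D [eb sCD]]] := coefb.
  rewrite ea eb !expgMn // -!expgM => e.
  have e1 := pi_indep p_pr pG genG ncG e.
  have e2 : B * i = D * j %[mod p].
    apply: (pi_indep p_pr pG genG' ncG (n := (A * i)%N) (n' := (C * j)%N)).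
    by rewrite -!cX.
  move: e1 e2; rewrite -!(mulnC i) -!(mulnC j).
  have [d sd dd] : exists2 d, d \in [:: 1; 2; 3; 4; 6]%N &
      (A * D = B * C + d \/ B * C = A * D + d)%N.
    move: sAB sCD; rewrite !inE => /or3P[]/eqP[-> ->] /or3P[]/eqP[-> ->].
    - by exists 2; [|left].
    - by exists 4; [|left].
    - by exists 6; [|left].
    - by exists 1%N; [|right].
    - by exists 1%N; [|right].
    - by exists 2; [|right].
    - by exists 1%N; [|left].
    - by exists 3; [|left].
    - by exists 4; [|left].
  exact: (slopes_indep p_ge5 sd dd).
exists x, y, u, v; split=> //; apply/eqP; rewrite eqEsubset; apply/andP; split; last first.
  rewrite sub1set inE; apply/andP; split; apply/SigmaP.
    by exists 1, x, 0; rewrite mem_head group1 conjg1.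
  by exists 1, u, 0; rewrite mem_head group1 conjg1.
apply/subsetP=> s.
rewrite inE => /andP[/SigmaP[g [a [k [Gg Ta es]]]] /SigmaP[h [b [l [Gh Tb es']]]]].
have Ga : a \in G by move: Ta; rewrite !inE => /or3P[] /eqP-> //; rewrite groupM.
have Gb : b \in G by move: Tb; rewrite !inE => /or3P[] /eqP-> //; rewrite groupM.
have nPa : a \notin Phi.
  apply/negP=> Pa; have := key a b 1%N 0%N Ta Tb.
  by rewrite coset_id // => /(_ erefl)[]; rewrite gtnNdvd // (leq_trans _ p_ge5).
have nPb : b \notin Phi.
  apply/negP=> Pb; have := key a b 0%N 1%N Ta Tb.
  by rewrite (coset_id Pb) => /(_ erefl)[_]; rewrite gtnNdvd // (leq_trans _ p_ge5).
have na := exp_q_neq1 leM Ga nPa; have nb := exp_q_neq1 leM Gb nPb.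
rewrite in_set1; apply: contraT => ns.
have Gs : s \in G by rewrite es groupJ ?groupX.
have [m os] : exists m, #[s] = (p ^ m.+1)%N.
  have /p_natP[[|m] os] := mem_p_elt pG Gs; last by exists m.
  by rewrite -order_eq1 os in ns.
have ns' : s ^+ (p ^ m) != 1.
  by rewrite -order_dvdn os dvdn_Pexp2l ?prime_gt1 // ltnn.
have sp : (s ^+ (p ^ m)) ^+ p = 1 by rewrite -expgM -expnSr -os expg_order.
have shape c t w : c \in G -> c ^+ q != 1 -> w \in G -> s = (c ^+ t) ^ w ->
    exists r, s ^+ (p ^ m) = ((c ^+ r) ^+ q) ^ w.
  move=> Gc nc Gw est; have [|r er] := @expg_order_p c (t * p ^ m)%N Gc nc.
    by apply: (conjg_inj w); rewrite expgM !conjXg -[(c ^ w) ^+ t]conjXg -est sp conj1g.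
  by exists r; rewrite est -conjXg -!expgM er.
have [i ei] := shape a k g Ga na Gg es; have [j ej] := shape b l h Gb nb Gh es'.
have ndvd : ~~ (p %| i).
  apply: contra ns' => /dvdnP[r er].
  by rewrite ei er -!expgM mulnAC !expgM exp_q_p ?groupX // conj1g.
have nPai : (a ^+ i) ^ g \notin Phi.
  rewrite memJ_norm ?norm_Phi //; apply: contra nPa => Pai.
  exact: mem_coprime_exp p_pr (mem_p_elt pG Ga) ndvd Pai.
have : pi ((a ^+ i) ^ g) = pi ((b ^+ j) ^ h).
  apply: (injH leM (groupJ (groupX _ Ga) Gg) (groupJ (groupX _ Gb) Gh) nPai).
  by rewrite -!conjXg -ei.
rewrite !pi_conj ?groupX // !morphX ?norm_Phi // => /(key _ _ _ _ Ta Tb)[].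
by rewrite (negbTE ndvd).
Qed.

Theorem Beauville_criterion : Beauville G <-> 5 <= p /\ (p ^ 2 <= #|'Mho^n(G)|)%N.
Proof.
split=> [[x1 [y1 [x2 [y2 bG]]]] | [p_ge5 leM]]; last exact: Beauville_of_Mho.
by split; [apply: Beauville_ge5 bG | apply: Beauville_Mho bG].
Qed.

End Criterion.

(** * Groups of exponent three, and injective power maps *)

Section ExponentThree.

Variables (gT : finGroupType) (G : {group gT}).
Hypothesis exp3 : {in G, forall x, x ^+ 3 = 1}.

(** The left-hand side is [(x * y^-1) ^+ 3 * y ^+ 3]. *)
Lemma exp3_cube x y : x \in G -> y \in G -> x * x ^ y * x ^ (y * y) = 1.
Proof.
move=> Gx Gy; have e1 := exp3 (groupM Gx (groupVr Gy)); have e2 := exp3 Gy.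
have cube (z : gT) : z ^+ 3 = z * z * z by rewrite !expgS expg0 mulg1 mulgA.
rewrite -[RHS]mulg1 -{1}e1 -e2 !cube !conjgE !invMg !mulgA.
by rewrite !(mulgK, mulgKV).
Qed.

(** Comparing [exp3_cube] for [y] and for [y * y = y^-1] shows that [x ^ y] and
    [x ^ (y * y)] commute; by [exp3_cube] again their product is [x^-1]. *)
Lemma exp3_commute_conj x y : x \in G -> y \in G -> commute x (x ^ y).
Proof.
move=> Gx Gy; have e1 := exp3_cube Gx Gy.
have := exp3_cube Gx (groupM Gy Gy).
have -> : y * y * (y * y) = y by rewrite mulgA -[y * y * y](expgSr y 2) exp3 ?mul1g.
rewrite -e1 -!mulgA => /mulgI cab.
have xV : x^-1 = x ^ y * x ^ (y * y).
  by apply: (mulgI x); rewrite mulgV mulgA e1.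
have caV : commute (x ^ y) x^-1 by rewrite /commute xV -!mulgA -cab.
by have /commute_sym := commuteV caV; rewrite invgK.
Qed.

Lemma exp3_commgl x y : x \in G -> y \in G -> commute x [~ x, y].
Proof.
move=> Gx Gy; rewrite commgEl; apply: commuteM; last exact: exp3_commute_conj.
exact/commuteV.
Qed.

Lemma exp3_commgr x y : x \in G -> y \in G -> commute y [~ x, y].
Proof.
by move=> Gx Gy; rewrite -invg_comm; apply: commuteV; apply: exp3_commgl.
Qed.

End ExponentThree.

Section BeauvilleOfPowerInjective.

Variables (gT : finGroupType) (p n : nat) (p_pr : prime p) (G : {group gT}).
Hypotheses (pG : p.-group G) (expG : exponent G = (p ^ n.+1)%N).
Hypothesis gen2 : two_generator G.
Local Notation q := (p ^ n)%N.
Hypothesis injG : power_injective q G.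

Let M := Group (Ldiv_group_set injG).

Let memM x : x \in G -> (x \in M) = (x ^+ q == 1).
Proof. by move=> Gx; rewrite !inE Gx. Qed.

Let sMG : M \subset G. Proof. exact: subsetIl. Qed.

Let nMG : G \subset 'N(M).
Proof.
apply/subsetP=> g Gg; rewrite inE; apply/subsetP=> _ /imsetP[x /LdivP[Gx xq] ->].
by rewrite memM ?groupJ // -conjXg xq conj1g.
Qed.

Let quo_exp x : x \in G / M -> x ^+ p = 1.
Proof.
case/morphimP=> y Ny Gy ->; rewrite -morphX //=; apply: coset_id.
by rewrite memM ?groupX // -expgM mulnC -expnSr -expG expg_exponent.
Qed.

Let expq_mod a b : a \in G -> b \in G -> coset M a = coset M b -> a ^+ q = b ^+ q.
Proof.
move=> Ga Gb /eqP; rewrite coset_eqE ?(subsetP nMG) // memM ?groupM ?groupV //.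
by rewrite -(power_injectiveE injG) // => /eqP.
Qed.

(** Otherwise [G] is generated by some [m] with [m ^+ q = 1] and one more
    element [c], and all [q]-th powers are powers of [c ^+ q]. *)
Lemma Ldiv_sub_Phi : (p ^ 2 <= #|'Mho^n(G)|)%N -> M \subset 'Phi(G).
Proof.
move=> leM; apply/subsetP=> m Mm; have Gm := subsetP sMG m Mm.
have [x [y genG]] := gen2; apply: contraT => nPm.
have [c Gc genmc] := complete_generator p_pr pG genG Gm nPm.
case/negP: (Mho_not_cycle p_pr expG Gc leM).
rewrite (MhoE _ pG) gen_subG; apply/subsetP=> _ /imsetP[v Gv ->].
have: v \in <[c]> * M.
  rewrite -norm_joinEl ?cycle_subG ?(subsetP nMG) //.
  apply: subsetP v Gv; rewrite -{1}genmc gen_subG; apply/subsetP=> t /set2P[]->.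
    by rewrite mem_gen // inE Mm orbT.
  by rewrite mem_gen // inE cycle_id.
case/mulsgP=> _ w /cycleP[i ->] Mw ->.
have -> : (c ^+ i * w) ^+ q = (c ^+ i) ^+ q.
  have Gw := subsetP sMG w Mw.
  by apply/eqP; rewrite injG ?groupX // -memM.
by rewrite -expgM mulnC expgM mem_cycle.
Qed.

(** The delicate point is the conjugacy of [a ^+ q] and [b ^+ q] for [p = 3]:
    the quotient by the solutions of [x ^+ q = 1] has exponent 3 and two
    generators, so its class is at most 2, and there a coset of the Frattini
    subgroup outside it is a single conjugacy class. *)
Theorem Beauville_of_power_injective :
  Beauville G <-> 5 <= p /\ (p ^ 2 <= #|'Mho^n(G)|)%N.
Proof.
apply: Beauville_criterion => //.
- exists M; last by move=> x Gx xq; rewrite memM ?xq.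
  have [x Gx nx] := exists_exp_q_neq1 p_pr expG.
  rewrite properE sMG; apply/subsetPn; exists x => //.
  by rewrite memM.
- move=> leM a b Ga Gb _ eab; apply/eqP.
  rewrite coset_eqE ?norm_Phi //; apply: (subsetP (Ldiv_sub_Phi leM)).
  by rewrite memM ?groupM ?groupV // -(power_injectiveE injG) // eab.
move=> p_lt5 leM a b Ga Gb nPa eab.
have [p2 | p3] : p = 2 \/ p = 3.
  by move: p_pr p_lt5; case: (p) => [|[|[|[|[|]]]]] //; [left | right].
- exists 1; rewrite // conjg1; apply: expq_mod => //; apply/eqP.
  rewrite coset_eqE ?(subsetP nMG) //.
  have sPM : 'Phi(G) \subset M.
    apply: (Phi_min pG nMG); rewrite p2; apply: exponent2_abelem.
    by apply/exponentP=> x Qx; rewrite -p2 quo_exp.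
  apply: (subsetP sPM); rewrite -coset_eqE ?norm_Phi //.
  by rewrite eab.
have exp3 : {in G / M, forall x, x ^+ 3 = 1} by move=> x Qx; rewrite -p3 quo_exp.
have [x [y genG]] := gen2.
have [c Gc genac] := complete_generator p_pr pG genG Ga nPa.
have Qa := mem_quotient M Ga; have Qc := mem_quotient M Gc.
set a' := coset M a in Qa *; set c' := coset M c in Qc *.
have defQ : G / M = <[a']> <*> <[c']>.
  have -> : G / M = <<[set a; c] / M>>.
    by rewrite -quotient_gen ?genac //; apply/subsetP=> t /set2P[]->; apply: (subsetP nMG).
  rewrite /quotient morphimU !morphim_set1 ?(subsetP nMG) //=.
  by rewrite -joingE -joing_idl -joing_idr.
(* in exponent 3, the commutator of the two generators is central *)
have defQ' : (G / M)^`(1) = <[[~ a', c']]>.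
  rewrite defQ; apply: der1_joing_cycles.
  rewrite centY !cent_cycle; apply/setIP; split; apply/cent1P.
    exact/commute_sym/(exp3_commgl exp3 Qa Qc).
  exact/commute_sym/(exp3_commgr exp3 Qa Qc).
have Phi1 : coset M (a^-1 * b) \in 'Phi(G / M).
  rewrite -(morphim_Phi (coset_morphism M) pG nMG) mem_morphim //.
    by rewrite (subsetP nMG) ?groupM ?groupV.
  by rewrite -coset_eqE ?norm_Phi // eab.
have [k ek] : exists k, coset M (a^-1 * b) = [~ a', c'] ^+ k.
  apply/cycleP; rewrite -defQ'; move: Phi1; rewrite (Phi_joing (quotient_pgroup M pG)).
  suffices -> : 'Mho^1(G / M) = 1 by rewrite joingG1.
  have E := MhoE 1 (quotient_pgroup M pG); apply/trivgP; rewrite /= E gen_subG.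
  by apply/subsetP=> _ /imsetP[t Qt ->]; rewrite expn1 quo_exp.
(* conjugation by c ^+ k multiplies a by the k-th power of [~ a, c] *)
exists (c ^+ k); first exact: groupX.
rewrite conjXg; apply: expq_mod; rewrite ?groupJ ?groupX //.
have Gab : a^-1 * b \in G by rewrite groupM ?groupV.
rewrite -[b](mulKVg a) morphM ?(subsetP nMG) //= ek.
rewrite morphJ ?morphX ?(subsetP nMG) ?groupX //= -/a' -/c'.
rewrite conjg_mulR commgX //.
exact: (exp3_commgr exp3 Qa Qc).
Qed.

End BeauvilleOfPowerInjective.

(** * Potent groups and the main equivalence *)

Section PotentBeauville.

Variables (gT : finGroupType) (p n : nat) (G : {group gT}).
Hypotheses (p_pr : prime p) (p_ge5 : 5 <= p) (pG : p.-group G).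
Hypothesis expG : exponent G = (p ^ n.+1)%N.
Hypothesis gen2 : two_generator G.
Hypothesis potG : 'L_(p - 1)(G) \subset 'Mho^1(G).
Local Notation q := (p ^ n)%N.

Let M i := iter_Mho n 'L_i.+1(G)%G.

Let p_gt2 : 2 < p. Proof. exact: leq_trans p_ge5. Qed.
Let fM := potent_filtration p_pr p_gt2 pG potG.

Let powM i x w : x \in G -> w \in 'L_i.+1(G) ->
  (x ^+ q * w ^+ q)^-1 * (x * w) ^+ q \in M i.+1.
Proof. by move=> Gx Lw; apply: (pf_expgM_iter pG fM n Gx Lw). Qed.

Let nM i : M i <| G := iter_Mho_normal n (lcn_normal _ _).
Let sMS i : M i.+1 \subset M i. Proof. exact: (pf_subS fM). Qed.

Let S i := [set u in 'L_i.+1(G) | u ^+ q \in M i.+1].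

Let gS i : group_set (S i).
Proof.
apply/group_setP; split=> [|u v]; first by rewrite inE group1 expg1n group1.
rewrite !inE => /andP[Lu Mu] /andP[Lv Mv]; rewrite groupM //=.
have := powM (subsetP (lcn_sub _ _) _ Lu) Lv.
by rewrite groupMl // groupV groupM.
Qed.

Let nS i : G \subset 'N(S i).
Proof.
apply/subsetP=> g Gg; rewrite inE; apply/subsetP=> _ /imsetP[u + ->].
rewrite !inE -conjXg => /andP[Lu Mu].
by rewrite !memJ_norm ?Lu // (subsetP (lcn_norm _ _), subsetP (normal_norm (nM _))).
Qed.

(* f [~ u, g] = (f u)^-1 * f (u ^ g) up to M i.+2, where f x = x ^+ q *)
Let commS i u g : u \in 'L_i.+1(G) -> g \in G -> u ^+ q \in M i.+1 ->
  [~ u, g] \in S i.+1.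
Proof.
move=> Lu Gg Mu; have Lc : [~ u, g] \in 'L_i.+2(G) by rewrite lcnSn mem_commg.
rewrite inE Lc; have := powM (subsetP (lcn_sub _ _) _ Lu) Lc.
rewrite -conjg_mulR -conjXg invMg -mulgA -commgEl groupMr ?groupV //.
apply: (subsetP (potent_comm_iter p_pr p_gt2 pG potG i.+1 n)).
exact: mem_commg.
Qed.

(* If f : x |-> x ^+ q maps 'L_i.+1(G) into M i.+1, then f [~ u, g] is congruent
   to [~ f u, g] and so lies one step deeper; hence M i, M i.+1 and all later
   terms coincide. *)
Let collapse i : 'L_i.+1(G) \subset S i -> M i = 1%G.
Proof.
move=> sLS; have sL k : 'L_(k + i).+1(G) \subset S (k + i).
  elim: k => // k IHk; rewrite addSn lcnSn.
  rewrite (gen_subG _ (Group (gS _))).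
  apply/subsetP=> _ /imset2P[u g Lu Gg ->]; apply: commS => //.
  by have := subsetP IHk u Lu; rewrite inE => /andP[].
have sM k : M i \subset M (k + i).
  elim: k => // k IHk; apply: subset_trans IHk _.
  apply/subsetP=> v /(pf_repr pG fM)[u Lu].
  have := subsetP (sL k) u Lu; rewrite inE => /andP[_ Mu].
  by rewrite groupMl ?groupV.
have [N MN] := pf_nil fM; apply/val_inj/trivgP.
rewrite -[[1]]/(gval 1) -(MN n) -/(M N).
apply: subset_trans (sM N) _; rewrite addnC.
by elim: i {sLS sL sM} => [|i IHi]; rewrite ?addn0 ?addnS // (subset_trans (sMS _)).
Qed.

Let MhoE0 : 'Mho^n(G)%G = M 0.
Proof. by rewrite -(pf_MhoE pG fM). Qed.

Let S0_proper : Group (gS 0) \proper G.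
Proof.
rewrite properE; apply/andP; split.
  by apply/subsetP=> u; rewrite inE => /andP[].
apply/negP=> sGS; have M1 := @collapse 0 sGS; have [x Gx] := exists_exp_q_neq1 p_pr expG.
by case/negP; rewrite -in_set1 -[[set 1]]/(gval 1%G) -M1 -MhoE0 exp_q_Mho.
Qed.

Let S0_sub_Phi : (p ^ 2 <= #|'Mho^n(G)|)%N -> S 0 \subset 'Phi(G).
Proof.
move=> leM; apply/subsetP=> m; rewrite inE => /andP[Gm Mm].
have [x [y genG]] := gen2; apply: contraT => nPm.
have [c Gc genmc] := complete_generator p_pr pG genG Gm nPm.
have genY : <[m]> <*> <[c]> = G.
  by rewrite joing_idl joing_idr joingE genmc.
have M1 : M 1 = 1%G.
  apply: collapse; rewrite lcn2 -{1}genY.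
  apply: (@commuting_gen_der _ G (Group (gS 1))) => //.
    exact: nS.
  exact: (commS Gm Gc Mm).
have powD u v : u \in G -> v \in G -> (u * v) ^+ q = u ^+ q * v ^+ q.
  move=> Gu Gv; have := @powM 0 u v Gu Gv; rewrite M1 => /set1P/eqP.
  by rewrite -eq_mulVg1 => /eqP.
case/negP: (Mho_not_cycle p_pr expG Gc leM).
rewrite (MhoE _ pG) gen_subG; apply/subsetP=> _ /imsetP[v Gv ->].
pose T := [set u in G | u ^+ q \in <[c ^+ q]>].
have gT0 : group_set T.
  apply/group_setP; split=> [|u1 u2]; first by rewrite inE group1 expg1n group1.
  rewrite !inE => /andP[Gu Cu] /andP[Gv' Cv].
  by rewrite groupM //= powD // groupM.
suffices /subsetP/(_ v Gv) : G \subset Group gT0 by rewrite inE => /andP[].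
rewrite -{1}genmc gen_subG; apply/subsetP=> t /set2P[]->; rewrite inE.
  rewrite lcn1 in Gm; rewrite Gm; move: Mm; rewrite M1 => /set1P->; exact: group1.
by rewrite Gc cycle_id.
Qed.

(** The solutions of [x ^+ q = 1] are replaced by the kernel [S 0] of the
    [q]-th power map modulo [M 1], a genuine homomorphism. *)
Theorem Beauville_of_potent :
  Beauville G <-> 5 <= p /\ (p ^ 2 <= #|'Mho^n(G)|)%N.
Proof.
apply: Beauville_criterion => //.
- exists (Group (gS 0)); first exact: S0_proper.
  by move=> x Gx xq; rewrite inE Gx xq group1.
- move=> leM a b Ga Gb _ eab; apply/eqP; rewrite coset_eqE ?norm_Phi //.
  apply: (subsetP (S0_sub_Phi leM)).
  have Gab : a^-1 * b \in G by rewrite groupM ?groupV.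
  rewrite inE Gab; have := @powM 0 a _ Ga Gab; rewrite mulKVg -eab invMg.
  by rewrite mulgKV groupV.
by rewrite ltnNge p_ge5.
Qed.

End PotentBeauville.

Theorem corollary2p6 (gT : finGroupType) (G : {group gT}) (p e : nat)
    (p_pr : prime p) (pG : p.-group G) (gen2 : two_generator G)
    (e_gt0 : 0 < e) (expG : exponent G = (p ^ e)%N)
    (famG : (regular_pgroup p G \/ #|G| <= p ^ p)
         \/ (potent p G \/ powerful p G)
         \/ (generalised_pcentral p G \/ pcentral p G)
         \/ (odd p /\ 'Ohm_1('L_(p - 1)(G)) \subset 'Z(G))) :
  Beauville G <-> 5 <= p /\ p ^ 2 <= #|'Mho^(e - 1)(G)|.
Proof.
case: e e_gt0 expG => // n _ expG; rewrite subn1 /=.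
have expG1 : {in G, forall x, x ^+ (p ^ n.+1) = 1}.
  by move=> x Gx; rewrite -expG expg_exponent.
have injB : power_injective (p ^ n) G ->
    Beauville G <-> 5 <= p /\ p ^ 2 <= #|'Mho^n(G)|.
  exact: Beauville_of_power_injective.
have p_gt2 : p != 2 -> 2 < p by rewrite ltn_neqAle eq_sym prime_gt1 // => ->.
have potB : potent p G -> Beauville G <-> 5 <= p /\ p ^ 2 <= #|'Mho^n(G)|.
  rewrite /potent; have [p2 potG | np2 potG] := eqVneq p 2.
    apply: injB; have p2G : 2.-group G by rewrite -p2.
    rewrite p2 in expG1 *.
    apply: (pf_power_injective p2G (powerful2_filtration p2G potG)) => //.
  have /orP[p_ge5 | p_lt5] : (4 < p) || (p < 5) by case: ltnP.
    exact: Beauville_of_potent.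
  have p3 : p = 3.
    by move: p_pr p_lt5 np2; case: (p) => [|[|[|[|[|]]]]].
  apply: injB; have fM := potent_filtration p_pr (p_gt2 np2) pG potG.
  apply: (pf_power_injective pG fM) => // j.
  by have := potent_shift p_pr (p_gt2 np2) pG potG 0 j; rewrite p3.
have genB : generalised_pcentral p G -> Beauville G <-> 5 <= p /\ p ^ 2 <= #|'Mho^n(G)|.
  rewrite /generalised_pcentral; have [p2 ZG | np2 ZG] := eqVneq p 2.
    exact/injB/power_injective_2central.
  by apply/injB/power_injective_gen_central => //; apply: p_gt2.
case: famG => [[regG | leG] | [[potG | powG] | [[genG | cenG] | [p_odd ZG]]]].
- exact/injB/power_injective_regular.
- apply/injB/power_injective_lcn => //.
  have [k ek] := p_natP pG.
  have le_kp : k <= p by rewrite -(leq_exp2l _ _ (prime_gt1 p_pr)) -ek.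
  have p_gt0 := prime_gt0 p_pr.
  rewrite -(prednK p_gt0); apply/(lcn_nil_classP _ (pgroup_nil pG)).
  apply: leq_trans (nil_class_pgroup pG) _.
  rewrite geq_max -ltnS prednK // prime_gt1 //= ek pfactorK //.
  by rewrite -!subn1 leq_sub2r.
- exact: potB.
- apply: potB; move: powG; rewrite /powerful /potent; case: eqVneq => // np2.
  by apply: subset_trans; rewrite -lcn2 lcn_sub_leq // ltn_subRL p_gt2.
- exact: genB.
- apply: genB; move: cenG; rewrite /pcentral /generalised_pcentral; case: eqVneq => // np2.
  move/subset_trans; apply; rewrite -ucn1 ucn_sub_geq //.
  by rewrite ltn_subRL p_gt2.
exact/injB/power_injective_Ohm_lcn.
Qed.
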